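(* There exist $r\in(0,1)$, a $2\times2$ rotation matrix $R$ with $R^{n}\neq \mathrm{Id}$ for all integers $n\ge1$, a finite index set $I$, and vectors $a_i\in\mathbb{R}^2$ ($i\in I$) such that the homogeneous planar self-similar IFS $\{\varphi_{i}(x)=rRx+a_{i}\}_{i\in I}$ satisfies the strong separation condition, and the self-similar measure $\mu$ (the unique compactly supported Borel probability measure with $\mu=\sum_{i\in I}|I|^{-1}\cdot\varphi_{i}\mu$) satisfies $\dim\mu>1$, and each of the sets \[ \{u\in S\::\:P_{u}\mu\text{ is singular}\} \quad\text{and}\quad \{u\in S\::\:\mu_{u,x}\text{ is discrete for }\mu\text{-a.e. }x\in\mathbb{R}^{2}\} \] contains a dense $G_{\delta}$ subset of $S$.
   Context: $S$ is the unit circle of $\mathbb{R}^2$. For $u\in S$, $P_u$ denotes the orthogonal projection onto the line spanned by $u$, and $\varphi_i\mu$ denotes the pushforward of $\mu$ under $\varphi_i$. The strong separation condition means that the sets $\varphi_i(K)$, $i\in I$, are pairwise disjoint, where $K$ is the attractor of the IFS. For $u\in S$, $\{\mu_{u,x}\}_{x\in\mathbb{R}^2}$ is the disintegration of $\mu$ with respect to the $\sigma$-algebra $P_u^{-1}(\mathcal{B})$ ($\mathcal{B}$ the Borel $\sigma$-algebra): each $\mu_{u,x}$ is a Borel probability measure supported on $P_u^{-1}(P_u x)$, and for every bounded Borel $f$, $\int f\,d\mu_{u,x}=E_\mu(f\mid P_u^{-1}(\mathcal{B}))(x)$ for $\mu$-a.e. $x$. A measure is discrete if it is supported on a countable set.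 $\dim\mu$ denotes the (exact) dimension of $\mu$. *)

(* Defs.v *)
From HB Require Import structures.
From mathcomp Require Import all_boot all_order all_algebra.
From mathcomp Require Import all_classical all_reals all_analysis.
Set Implicit Arguments. Unset Strict Implicit. Unset Printing Implicit Defensive.
Import Order.TTheory GRing.Theory Num.Theory.
Import numFieldNormedType.Exports.
Local Open Scope classical_set_scope.
Local Open Scope ring_scope.

(* The plane R^2 is modelled as (R * R)%type with its product (= Borel)
   sigma-algebra and product topology. *)

Definition dot2 (R : realType) (x u : R * R) : R := x.1 * u.1 + x.2 * u.2.

Definition unit_circle (R : realType) : set (R * R) :=
  [set u | u.1 ^+ 2 + u.2 ^+ 2 = 1].

Definition eball (R : realType) (x : R * R) (rho : R) : set (R * R) :=
  [set y | (y.1 - x.1) ^+ 2 + (y.2 - x.2) ^+ 2 < rho ^+ 2].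

Definition mxapp (R : realType) (M : 'M[R]_2) (p : R * R) : R * R :=
  (M 0 0 * p.1 + M 0 1 * p.2, M 1 0 * p.1 + M 1 1 * p.2).

Definition rotation_mx (R : realType) (M : 'M[R]_2) : Prop :=
  M *m M^T = 1%:M /\ \det M = 1.

Definition sim_map (R : realType) (r : R) (M : 'M[R]_2) (a : R * R)
  (p : R * R) : R * R :=
  (r * (mxapp M p).1 + a.1, r * (mxapp M p).2 + a.2).

(* strong separation condition: the attractor K (the unique nonempty
   compact set with K = U_i phi_i(K)) has pairwise disjoint pieces *)
Definition SSC (R : realType) (n : nat) (phi : 'I_n -> R * R -> R * R) : Prop :=
  exists K : set (R * R),
    [/\ compact K, K !=set0, K = \bigcup_(i in [set: 'I_n]) (phi i @` K) &
        forall i j : 'I_n, i != j -> (phi i @` K) `&` (phi j @` K) = set0].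

Definition self_similar (R : realType) (n : nat) (phi : 'I_n -> R * R -> R * R)
  (mu : probability (R * R)%type R) : Prop :=
  (exists K : set (R * R), compact K /\ mu (~` K) = 0%E) /\
  forall A : set (R * R), measurable A ->
    mu A = (\sum_(i < n) (n%:R^-1)%:E * mu (phi i @^-1` A))%E.

Definition exact_dim (R : realType) (mu : probability (R * R)%type R) (s : R) : Prop :=
  {ae mu, forall x,
    (fun rho : R => ln (fine (mu (eball x rho))) / ln rho) @ 0^'+ --> s}.

Definition singular_leb (R : realType) (nu : set R -> \bar R) : Prop :=
  exists A : set R, [/\ measurable A, (lebesgue_measure A = 0)%E & nu (~` A) = 0%E].

(* the projection P_u mu, transported to R via the isometry t u |-> t *)
Definition proj_measure (R : realType) (mu : probability (R * R)%type R) (u : R * R)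
  : set R -> \bar R := fun B => mu ((fun x => dot2 x u) @^-1` B).

(* nu is the disintegration of mu w.r.t. the sigma-algebra P_u^{-1}(Borel):
   each nu x is a probability measure supported on P_u^{-1}(P_u x), and for
   every bounded Borel f, x |-> \int f d(nu x) equals E_mu(f | P_u^{-1} B)
   mu-a.e.  (P_u^{-1} B-measurable functions are those of the form g(<x,u>)
   with g Borel; the conditional expectation is written out.) *)
Definition is_disintegration (R : realType) (mu : probability (R * R)%type R)
  (u : R * R) (nu : R * R -> probability (R * R)%type R) : Prop :=
  (forall x, nu x [set y | dot2 y u != dot2 x u] = 0%E) /\
  (forall f : R * R -> R, measurable_fun setT f ->
     (exists M : R, forall y, `|f y| <= M) ->
     exists g : R -> R,
       [/\ measurable_fun setT g,
           mu.-integrable setT (fun x => (g (dot2 x u))%:E),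
           (forall B : set R, measurable B ->
              (\int[mu]_(x in (fun x => dot2 x u) @^-1` B) (f x)%:E =
               \int[mu]_(x in (fun x => dot2 x u) @^-1` B) (g (dot2 x u))%:E)%E) &
           {ae mu, forall x, (\int[nu x]_y (f y)%:E)%E = (g (dot2 x u))%:E}]).

Definition discrete_measure (R : realType) (nu : probability (R * R)%type R) : Prop :=
  exists C : set (R * R), countable C /\ nu (~` C) = 0%E.

Definition contains_dense_Gdelta_of_S (R : realType) (D : set (R * R)) : Prop :=
  exists O : nat -> set (R * R),
    (forall k, open (O k)) /\
    ((@unit_circle R) `&` \bigcap_k O k `<=` D) /\
    (forall U : set (R * R), open U -> U `&` (@unit_circle R) !=set0 ->
       U `&` ((@unit_circle R) `&` \bigcap_k O k) !=set0).

(* Main.v *)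
(* Identify R^2 with the complex plane and put theta = 8 + i. The maps are
   x |-> x / conj(theta) + d, with d among the nine Gaussian integers having both
   coordinates in {-1, 0, 1}. Since theta is a Gaussian integer and the digits are
   Gaussian integers, the Fourier transform F of mu (at 2 pi times the frequency)
   satisfies F(theta^M + w) -> b F(w) as M -> oo for every w, with b = F(1) > 0.
   Consequently, if the frequencies xi_k u are asymptotic to theta^(M_k) + y, then
   the functions exp(2 pi i xi_k <x, u>) of the projection of x to u converge weakly
   in L^2(mu) to b exp(2 pi i <x, y>), and convex combinations of them, divided by
   b, converge strongly to exp(2 pi i <x, y>). As theta has irrational argument,
   the directions u having such frequencies for given y form a dense G_delta.
   - For y = 0, trigonometric polynomials converge to 1 in L^2 of the projection
     while they converge to 0 in L^2 of Lebesgue measure on a bounded interval by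
     the Riemann-Lebesgue lemma: the projection is singular.
   - For two small independent y, the point x is mu-almost surely a function of
     <x, u>, so the conditional measures are Dirac masses.
   Both uses take only the real parts, respectively the imaginary parts. *)
Require Import Defs.
From HB Require Import structures.
From mathcomp Require Import all_boot all_order all_algebra.
From mathcomp Require Import all_classical all_reals all_analysis measurable_realfun.
From mathcomp Require Import ring lra zify.
Import Order.TTheory GRing.Theory Num.Theory.
Import numFieldNormedType.Exports.
Set Implicit Arguments. Unset Strict Implicit. Unset Printing Implicit Defensive.
Local Open Scope classical_set_scope.
Local Open Scope ring_scope.

(** * Bounded measurable functions *)

Section BoundedMeasurable.
Context d (X : measurableType d) (R : realType).
Implicit Types h k : X -> R.

Definition bounded_measurable h :=
  measurable_fun setT h /\ exists M, forall x, `|h x| <= M.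

Lemma bm_cst (c : R) : bounded_measurable (fun=> c).
Proof. by split; [exact: measurable_cst | exists `|c|]. Qed.

Lemma bmD h k : bounded_measurable h -> bounded_measurable k ->
  bounded_measurable (fun x => h x + k x).
Proof.
move=> [mh [M hM]] [mk [N kN]]; split; first exact: measurable_funD.
by exists (M + N) => x; rewrite (le_trans (ler_normD _ _)) ?lerD.
Qed.

Lemma bmM h k : bounded_measurable h -> bounded_measurable k ->
  bounded_measurable (fun x => h x * k x).
Proof.
move=> [mh [M hM]] [mk [N kN]]; split; first exact: measurable_funM.
by exists (M * N) => x; rewrite normrM ler_pM.
Qed.

Lemma bmZ (c : R) h : bounded_measurable h -> bounded_measurable (fun x => c * h x).
Proof. by move=> bh; apply: bmM => //; exact: bm_cst. Qed.

Lemma bmB h k : bounded_measurable h -> bounded_measurable k ->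
  bounded_measurable (fun x => h x - k x).
Proof.
move=> bh bk; under [X in bounded_measurable X]eq_fun do rewrite -mulN1r.
by apply: bmD => //; exact: bmZ.
Qed.

Variables (m : {measure set X -> \bar R}) (D : set X).
Hypotheses (mD : measurable D) (finD : (m D < +oo)%E).

Lemma bm_integrable h : bounded_measurable h -> m.-integrable D (EFin \o h).
Proof.
move=> [mh [M hM]]; apply: measurable_bounded_integrable => //.
  exact: measurable_funTS.
exists M; split; first by rewrite num_real.
by move=> y My x _; exact: le_trans (hM x) (ltW My).
Qed.

Lemma bm_intD h k : bounded_measurable h -> bounded_measurable k ->
  \int[m]_(x in D) (h x + k x) = \int[m]_(x in D) h x + \int[m]_(x in D) k x.
Proof. by move=> bh bk; apply: RintegralD => //; exact: bm_integrable. Qed.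

Lemma bm_intB h k : bounded_measurable h -> bounded_measurable k ->
  \int[m]_(x in D) (h x - k x) = \int[m]_(x in D) h x - \int[m]_(x in D) k x.
Proof. by move=> bh bk; apply: RintegralB => //; exact: bm_integrable. Qed.

Lemma bm_intZ (c : R) h : bounded_measurable h ->
  \int[m]_(x in D) (c * h x) = c * \int[m]_(x in D) h x.
Proof. by move=> bh; apply: RintegralZl => //; exact: bm_integrable. Qed.

Lemma bm_int_le h k : bounded_measurable h -> bounded_measurable k ->
  (forall x, D x -> h x <= k x) ->
  \int[m]_(x in D) h x <= \int[m]_(x in D) k x.
Proof. by move=> bh bk; apply: le_Rintegral => //; exact: bm_integrable. Qed.

Lemma bm_int_norm_le (M : R) h : bounded_measurable h ->
  (forall x, D x -> `|h x| <= M) ->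
  `|\int[m]_(x in D) h x| <= M * fine (m D).
Proof.
move=> bh hM; rewrite ler_norml -mulNr -!(Rintegral_cst m mD); apply/andP; split;
  by apply: bm_int_le => //; [exact: bm_cst | move=> x /hM; rewrite ler_norml => /andP[]].
Qed.

Lemma bm_chebyshev (a : R) h : bounded_measurable h -> 0 < a ->
  (m (D `&` [set x | (a <= `|h x|)%R]) <= ((\int[m]_(x in D) (h x ^+ 2)) / a ^+ 2)%R%:E)%E.
Proof.
move=> bh a0; have mh := bh.1.
have mE : measurable [set x | a <= `|h x|].
  rewrite -[X in measurable X]setTI.
  have -> : [set x | a <= `|h x|] = (Num.norm \o h) @^-1` `[a, +oo[.
    by apply/seteqP; split => x /=; rewrite in_itv /= andbT.
  by apply: measurableT_comp.
have mDE : measurable (D `&` [set x | a <= `|h x|]) by exact: measurableI.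
have bh2 : bounded_measurable (fun x => h x ^+ 2).
  by under [X in bounded_measurable X]eq_fun do rewrite expr2; exact: bmM.
have fDE : m (D `&` [set x | a <= `|h x|]) \is a fin_num.
  rewrite ge0_fin_numE // (le_lt_trans _ finD) // le_measure ?inE //.
have bi : bounded_measurable (fun x => a ^+ 2 * \1_[set x | a <= `|h x|] x).
  apply: bmZ; split; first by exact: measurable_indic.
  by exists 1 => x; rewrite indicE; case: (_ \in _); rewrite ?normr1 ?normr0.
rewrite -(fineK fDE) lee_fin ler_pdivlMr ?exprn_gt0 // mulrC.
have -> : a ^+ 2 * fine (m (D `&` [set x | a <= `|h x|])) =
    \int[m]_(x in D) (a ^+ 2 * \1_[set x | a <= `|h x|] x).
  rewrite bm_intZ; last first.
    split; first by exact: measurable_indic.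
    by exists 1 => x; rewrite indicE; case: (_ \in _); rewrite ?normr1 ?normr0.
  by rewrite /Rintegral integral_indic // setIC.
apply: bm_int_le => // x Dx; rewrite indicE.
case: (boolP (x \in _)) => [|_] /=; last by rewrite mulr0 sqr_ge0.
rewrite inE /= => ah; rewrite mulr1 -[leRHS]real_normK ?num_real ?ler_sqr // nnegrE ?normr_ge0 //.
exact: ltW.
Qed.

(** The expansion along a segment that the averaging argument [small_quadratic_form] demands of its
    form. *)
Lemma bm_int_mix (t : R) h k : bounded_measurable h -> bounded_measurable k ->
  \int[m]_(x in D) (((1 - t) * h x + t * k x) * ((1 - t) * h x + t * k x)) =
  (1 - t) ^+ 2 * \int[m]_(x in D) (h x * h x)
  + 2 * t * (1 - t) * \int[m]_(x in D) (h x * k x)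
  + t ^+ 2 * \int[m]_(x in D) (k x * k x).
Proof.
move=> bh bk; have bhh := bmM bh bh; have bhk := bmM bh bk; have bkk := bmM bk bk.
rewrite -!bm_intZ // -!bm_intD //; try (by do ?[exact: bmZ | apply: bmD]).
by apply: eq_Rintegral => x _; ring.
Qed.

End BoundedMeasurable.

(* One step replaces S by the mean (n S + S') / (n + 1) with S' almost
   orthogonal to S, as in the proof of Mazur's theorem. *)
Lemma small_quadratic_form (R : realType) (V : Type) (A : set V)
    (mix : R -> V -> V -> V) (Q : V -> V -> R) (B : R) :
  0 < B ->
  (exists S, A S /\ Q S S <= B) ->
  (forall t S S', A S -> A S' -> A (mix t S S')) ->
  (forall t S S', A S -> A S' -> Q (mix t S S') (mix t S S') =
     (1 - t) ^+ 2 * Q S S + 2 * t * (1 - t) * Q S S' + t ^+ 2 * Q S' S') ->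
  (forall S e, A S -> 0 < e -> exists S', [/\ A S', Q S' S' <= B & Q S S' <= e]) ->
  forall e, 0 < e -> exists S, A S /\ Q S S <= e.
Proof.
move=> B0 [S0 [AS0 QS0]] Amix Qmix step.
suff H n : exists S, A S /\ Q S S <= 2 * B / n.+1%:R.
  move=> e e0; have be0 : 0 <= 2 * B / e by rewrite divr_ge0 ?mulr_ge0 ?ltW.
  have [S [AS QS]] := H (Num.trunc (2 * B / e)).
  exists S; split => //; rewrite (le_trans QS) // ler_pdivrMr ?ltr0n // -ler_pdivrMl //.
  by rewrite mulrC; exact: ltW (truncnS_gt _).
elim: n => [|n [S [AS QS]]].
  by exists S0; split => //; rewrite divr1; lra.
have n0 : 0 < n.+1%:R :> R by rewrite ltr0n.
(* With N = n + 1 this error makes 2 N [Q S S'] at most B. Together with N^2 [Q S S] <= 2 B N and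
   [Q S' S'] <= B, the numerator is at most 2 B (N + 1). *)
have [S' [AS' QS' QSS']] := step S (B / (2 * n.+1%:R)) AS (divr_gt0 B0 (mulr_gt0 (ltr0n _ 2) n0)).
exists (mix (n.+2%:R^-1) S S'); split; first exact: Amix.
rewrite Qmix //.
have n20 : 0 < n.+2%:R :> R by rewrite ltr0n.
have nE : n.+2%:R = n.+1%:R + 1 :> R by rewrite -natr1.
set N := n.+1%:R in n0 nE QS QSS' *.
have -> : 1 - n.+2%:R^-1 = N / n.+2%:R by rewrite nE; field; lra.
set M := n.+2%:R in n20 nE *.
have M0 : M != 0 by rewrite gt_eqF.
have -> : (N / M) ^+ 2 * Q S S + 2 * M^-1 * (N / M) * Q S S' + M^-1 ^+ 2 * Q S' S' =
   (N ^+ 2 * Q S S + 2 * N * Q S S' + Q S' S') / M ^+ 2 by field.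
have -> : 2 * B / M = (2 * B * M) / M ^+ 2 by field.
rewrite ler_pM2r ?invr_gt0 ?exprn_gt0 //.
have h1 : N ^+ 2 * Q S S <= N * (2 * B).
  by rewrite expr2 -mulrA ler_pM2l // mulrC -ler_pdivlMr.
have h2 : 2 * N * Q S S' <= B.
  by rewrite mulrC -ler_pdivlMr // mulr_gt0.
rewrite nE; lra.
Qed.

(** * The iterated function system *)

Section System.
Variable R : realType.
Local Notation plane := (R * R)%type.
Implicit Types (x y z w : plane) (c : R).

(* With R^2 identified with the complex plane, [gmul] and [gdiv] are the
   multiplications by 8 + i and by its inverse, and [phi i] is
   x |-> x / (8 - i) + digit i; hence [gdiv] is the adjoint of the linear part
   of [phi i]. *)
Definition digit (i : 'I_9) : plane := ((i %% 3)%N%:R - 1, (i %/ 3)%N%:R - 1).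

Definition gmul x : plane := (8 * x.1 - x.2, x.1 + 8 * x.2).

Definition gdiv x : plane := ((8 * x.1 + x.2) / 65, (8 * x.2 - x.1) / 65).

Definition phi i x : plane :=
  ((8 * x.1 - x.2) / 65 + (digit i).1, (x.1 + 8 * x.2) / 65 + (digit i).2).

Definition phiV i x : plane :=
  (8 * (x.1 - (digit i).1) + (x.2 - (digit i).2),
   8 * (x.2 - (digit i).2) - (x.1 - (digit i).1)).

Lemma gmulK : cancel gmul gdiv.
Proof. by case=> a b; rewrite /gmul /gdiv /=; congr pair; field. Qed.

Lemma phiK i : cancel (phi i) (phiV i).
Proof. by case=> a b; rewrite /phi /phiV /=; congr pair; field. Qed.

Lemma phiVK i : cancel (phiV i) (phi i).
Proof. by case=> a b; rewrite /phi /phiV /=; congr pair; field. Qed.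

Lemma image_phi i (A : set plane) : phi i @` A = phiV i @^-1` A.
Proof.
apply/seteqP; split => [_ [x Ax <-]|x Ax] /=; first by rewrite phiK.
by exists (phiV i x) => //; rewrite phiVK.
Qed.

Lemma dot2_phi i x w :
  dot2 (phi i x) w = dot2 x (gdiv w) + dot2 (digit i) w.
Proof. by rewrite /dot2 /phi /gdiv /=; field. Qed.

Definition box c : set plane := [set x | `|x.1| <= c /\ `|x.2| <= c].

Lemma box_le c c' : c <= c' -> box c `<=` box c'.
Proof. by move=> cc' x [h1 h2]; split; exact: le_trans cc'. Qed.

(** 9/65 = (8 + 1)/65 is the sup-norm operator norm of division by 8 + i; the linear part of [phi i]
    has the same one. *)
Lemma box_gdiv c w : box c w -> box (9 / 65 * c) (gdiv w).
Proof. by case=> /= h1 h2; split => /=; move: h1 h2; rewrite !ler_norml; lra. Qed.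

Lemma digit_norm i : box 1 (digit i).
Proof.
have h (n : nat) : (n < 3)%N -> `|n%:R - 1| <= 1 :> R.
  by case: n => [|[|[|//]]] _; rewrite ler_norml; lra.
by split; apply: h; rewrite ?ltn_mod // ltn_divLR.
Qed.

Lemma box_phi i c x : box c x -> box (9 / 65 * c + 1) (phi i x).
Proof.
move=> [/= h1 h2]; have [/= h3 h4] := digit_norm i.
by split => /=; move: h1 h2 h3 h4; rewrite !ler_norml; lra.
Qed.

Lemma digit_sep i j : i != j ->
  1 <= `|(digit i).1 - (digit j).1| \/ 1 <= `|(digit i).2 - (digit j).2|.
Proof.
have h (m n : nat) : m != n -> 1 <= `|(m%:R - 1) - (n%:R - 1)| :> R.
  move=> mn; have -> : m%:R - 1 - (n%:R - 1) = m%:R - n%:R :> R by ring.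
  have lem (p q : nat) : (p < q)%N -> 1 <= `|p%:R - q%:R| :> R.
    move=> pq; rewrite distrC ler_normr; apply/orP; left.
    by rewrite lerBrDr addrC natr1 ler_nat.
  by case: (ltngtP m n) mn => // lt _; [exact: lem | rewrite distrC; exact: lem].
move=> ij; have [e|ne] := eqVneq (i %% 3)%N (j %% 3)%N; last by left; exact: h.
right; apply: h; apply: contra ij => /eqP e'; apply/eqP/val_inj => /=.
by rewrite (divn_eq i 3) (divn_eq j 3) e e'.
Qed.

(** Two digits differ by at least 1 in some coordinate, while the linear parts contribute at most 2
    (9/65)(5/4) = 9/26 < 1/2. *)
Lemma phi_sep i j x x' : i != j -> box (5 / 4) x -> box (5 / 4) x' ->
  1 / 2 < `|(phi i x).1 - (phi j x').1| \/ 1 / 2 < `|(phi i x).2 - (phi j x').2|.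
Proof.
move=> ij [/= x1 x2] [/= y1 y2].
case: (digit_sep ij) => /= h; [left|right]; move: x1 x2 y1 y2 h;
  rewrite !ler_norml !ler_normr !ltr_normr => x1 x2 y1 y2 /orP[h|h]; apply/orP;
    [left|right|left|right]; lra.
Qed.

(** * Measurability and topology in the plane *)

Lemma measurable_plane_fun (f g : plane -> R) :
  measurable_fun setT f -> measurable_fun setT g ->
  measurable_fun setT (fun x => (f x, g x) : plane).
Proof. by move=> mf mg; exact: measurable_fun_pair. Qed.

Lemma measurable_fun_affine (a b c : R) :
  measurable_fun setT (fun x : plane => a * x.1 + b * x.2 + c).
Proof.
by apply: measurable_funD => //; apply: measurable_funD; apply: measurable_funM.
Qed.

Lemma measurable_dot2 w : measurable_fun setT (fun x => dot2 x w).
Proof.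
have := measurable_fun_affine w.1 w.2 0; congr (measurable_fun _ _).
by apply/funext => x; rewrite /dot2; ring.
Qed.

Lemma measurable_phi i : measurable_fun setT (phi i).
Proof.
apply: measurable_plane_fun.
- have := measurable_fun_affine (8 / 65) (- 65^-1) (digit i).1; congr (measurable_fun _ _).
  by apply/funext => x; field.
- have := measurable_fun_affine (65^-1) (8 / 65) (digit i).2; congr (measurable_fun _ _).
  by apply/funext => x; field.
Qed.

Lemma measurable_box c : measurable (box c).
Proof.
have -> : box c = `[- c, c]%classic `*` `[- c, c]%classic.
  by apply/seteqP; split => -[a b] /=; rewrite !in_itv /= -!ler_norml => -[].
by apply: measurableX; exact: measurable_itv.
Qed.

Lemma compact_box c : compact (box c).
Proof.
have -> : box c = `[- c, c]%classic `*` `[- c, c]%classic.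
  by apply/seteqP; split => -[a b] /=; rewrite !in_itv /= -!ler_norml => -[].
by apply: compact_setX; exact: segment_compact.
Qed.

(** The sigma-algebra is the product one, so an open set is exhausted by the countably many
    rectangles with rational endpoints that it contains. *)
Lemma open_measurable_plane (A : set plane) : open A -> measurable A.
Proof.
move=> oA.
pose ob (q : rat * rat * rat * rat) : set plane :=
  `]ratr q.1.1.1, ratr q.1.1.2[%classic `*` `]ratr q.1.2, ratr q.2[%classic.
have -> : A = \bigcup_(q in [set q | ob q `<=` A]) ob q.
  apply/seteqP; split => [x Ax|x [q /= qA qx]]; last exact: qA.
  have /nbhs_ballP[e /= e0 be] : nbhs x A by exact: open_nbhs_nbhs.
  have [q1 /itvP q1h] := @rat_in_itvoo R (x.1 - e) (x.1) ltac:(lra).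
  have [q2 /itvP q2h] := @rat_in_itvoo R (x.1) (x.1 + e) ltac:(lra).
  have [q3 /itvP q3h] := @rat_in_itvoo R (x.2 - e) (x.2) ltac:(lra).
  have [q4 /itvP q4h] := @rat_in_itvoo R (x.2) (x.2 + e) ltac:(lra).
  exists (q1, q2, q3, q4); last by split => /=; rewrite in_itv /= ?q1h ?q2h ?q3h ?q4h.
  move=> y [/= ]; rewrite !in_itv /= => /andP[y1 y2] /andP[y3 y4]; apply: be.
  have a1 : x.1 - e < ratr q1 by rewrite q1h.
  have a2 : ratr q2 < x.1 + e by rewrite q2h.
  have a3 : x.2 - e < ratr q3 by rewrite q3h.
  have a4 : ratr q4 < x.2 + e by rewrite q4h.
  by split; rewrite /ball /= ltr_norml; lra.
rewrite bigcup_mkcond; apply: countable_bigcupT_measurable => // q; case: ifP => // _.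
apply: measurableX; exact: measurable_itv.
Qed.

Lemma closed_measurable_plane (A : set plane) : closed A -> measurable A.
Proof.
by move=> cA; rewrite -(setCK A); apply: measurableC; apply: open_measurable_plane; rewrite openC.
Qed.

Lemma compact_measurable_plane (A : set plane) : compact A -> measurable A.
Proof.
move=> cA; apply: closed_measurable_plane; apply: compact_closed cA;
  exact: (@norm_hausdorff _ plane).
Qed.

Lemma continuous_affine (a b c : R) :
  continuous (fun x : plane => a * x.1 + b * x.2 + c).
Proof.
move=> x; apply: cvgD; last exact: cvg_cst.
by apply: cvgD; apply: cvgM; [exact: cvg_cst|exact: cvg_fst|exact: cvg_cst|exact: cvg_snd].
Qed.

Lemma continuous_phiV i : continuous (phiV i).
Proof.
have h1 : continuous (fun x => (phiV i x).1).
  rewrite (_ : (fun _ => _) = fun x => 8 * x.1 + 1 * x.2 + (- 8 * (digit i).1 - (digit i).2)).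
    exact: continuous_affine.
  by apply/funext => z; rewrite /phiV /=; ring.
have h2 : continuous (fun x => (phiV i x).2).
  rewrite (_ : (fun _ => _) = fun x => - 1 * x.1 + 8 * x.2 + (- 8 * (digit i).2 + (digit i).1)).
    exact: continuous_affine.
  by apply/funext => z; rewrite /phiV /=; ring.
by move=> x; exact: cvg_pair (h1 x) (h2 x).
Qed.

(** Decreasing approximations whose intersection is the attractor. The radius 5/4 exceeds the fixed
    point 65/56 of c -> 9/65 c + 1, so the initial box is mapped into itself. *)
Definition stage n : set plane :=
  iter n (fun A => \bigcup_(i in [set: 'I_9]) (phi i @` A)) (box (5 / 4)).

Lemma stageS n : stage n.+1 = \bigcup_(i in [set: 'I_9]) (phi i @` stage n).
Proof. by []. Qed.

Lemma closed_stage n : closed (stage n).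
Proof.
elim: n => [|n IH].
  apply: compact_closed; [exact: (@norm_hausdorff _ plane) | exact: compact_box].
rewrite stageS; apply: closed_bigcup => [|i _]; first exact: finite_finset.
rewrite image_phi; apply: closed_comp => // x _; exact: continuous_phiV.
Qed.

Lemma measurable_stage n : measurable (stage n).
Proof. by apply: closed_measurable_plane; exact: closed_stage. Qed.

Lemma stage_decr n : stage n.+1 `<=` stage n.
Proof.
elim: n => [|n IH] x [i _ [y Ky <-]].
  by apply: box_le (box_phi i Ky); lra.
by exists i => //; exists y => //; exact: IH.
Qed.

Lemma stage_box n : stage n `<=` box (5 / 4).
Proof. by elim: n => [//|n IH] x /stage_decr; exact: IH. Qed.

Lemma phi_disjoint i j x x' : box (5 / 4) x -> box (5 / 4) x' ->
  phi i x = phi j x' -> i = j.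
Proof.
move=> bx bx' e; apply/eqP; apply: contraT => ij.
by case: (phi_sep ij bx bx'); rewrite e subrr normr0; lra.
Qed.

Lemma phi_SSC : SSC phi.
Proof.
exists (\bigcap_n stage n); split.
- apply: (@subclosed_compact _ _ (box (5 / 4))).
  + by apply: closed_bigI => n _; exact: closed_stage.
  + exact: compact_box.
  + by move=> x /(_ 0%N I).
- exists (0, 0) => n _; elim: n => [|n IH].
    by split; rewrite /= normr0; lra.
  (* Digit number 4 is (0, 0), so its map fixes the origin. *)
  exists (@Ordinal 9 4 isT) => //; exists (0, 0) => //; rewrite /phi.
  have -> : digit (@Ordinal 9 4 isT) = (0, 0) by congr pair; exact: subrr.
  by congr pair; rewrite /=; lra.
- apply/seteqP; split => [x Kx|_ [i _ [x Kx <-]] n _]; last first.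
    by apply: stage_decr; exists i => //; exists x => //; exact: Kx.
  (* The index j through which x lies in stage n + 1 could depend on n; disjointness of the pieces
     forces j = i, and injectivity of [phi i] then forces the preimage to be y for every n. *)
  have [i _ [y Ky xy]] := Kx 1%N I; exists i => //; exists y => // n _.
  have [j _ [z Kz xz]] := Kx n.+1 I.
  have ji : j = i by apply: phi_disjoint (stage_box Kz) Ky _; rewrite xz xy.
  by have -> : y = z by apply: (can_inj (phiK i)); rewrite xy -xz ji.
- move=> i j ij; apply/seteqP; split => // x [[y Ky <-] [z Kz zy]].
  by move/eqP: ij; apply; symmetry; apply: phi_disjoint (Kz 0%N I) (Ky 0%N I) zy.
Qed.

End System.

Lemma pow_small (R : realType) (q M e : R) : 0 <= q < 1 -> 0 < e ->
  exists N, forall n, (N <= n)%N -> `|q ^+ n * M| <= e.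
Proof.
move=> /andP[q0 q1] e0.
have : q ^+ n * M @[n --> \oo] --> 0 * M.
  by apply: cvgMl; apply: cvg_expr; rewrite ger0_norm.
rewrite mul0r => /cvgr0Pnorm_le /(_ e e0) [N _ h].
by exists N => n Nn; exact: h.
Qed.

(** * Support and invariance of a self-similar measure *)

Section SelfSimilar.
Variable R : realType.
Local Notation plane := (R * R)%type.
Variable mu : probability (R * R)%type R.
Hypothesis mu_ss : self_similar (@phi R) mu.
Implicit Types (x y z w : plane) (c : R).

Let box_outside_phi c : mu (~` box c) = 0%E -> mu (~` box (9 / 65 * c + 1)) = 0%E.
Proof.
move=> h; rewrite mu_ss.2; last by apply: measurableC; exact: measurable_box.
rewrite big1 // => i _; rewrite [mu _](_ : _ = 0%E) ?mule0 //.
apply: (subset_measure0 _ _ _ h).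
- rewrite -[X in measurable X]setTI.
  by apply: (measurable_phi i) => //; (by apply: measurableC; exact: measurable_box).
- by (by apply: measurableC; exact: measurable_box).
- by move=> x /= nx bx; apply: nx; exact: box_phi.
Qed.

Lemma mu_outside_box : mu (~` box (5 / 4)) = 0%E.
Proof.
have [[K [cK muK]] _] := mu_ss.
have [M KM] : exists M, K `<=` box M.
  have [M [_ KM]] := compact_bounded cK.
  exists (M + 1) => x Kx; have := KM (M + 1) ltac:(by rewrite ltrDl) x Kx.
  by rewrite /= prod_normE ge_max => /andP[].
have mK := compact_measurable_plane cK.
(* 65/56 is the fixed point of c -> 9/65 c + 1, so the excess M shrinks by 9/65 at each step until
   it fits into 5/4 - 65/56 = 5/56. *)
have step n : mu (~` box (65 / 56 + (9 / 65) ^+ n * M)) = 0%E.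
  elim: n => [|n /box_outside_phi].
    apply: (subset_measure0 _ _ _ muK); try exact: measurableC; try (by apply: measurableC;
      exact: measurable_box).
    by move=> x nx Kx; apply: nx; apply: box_le (KM _ Kx); rewrite expr0; lra.
  by congr (mu (~` box _) = _); rewrite exprS; field.
have [N hN] := @pow_small R (9 / 65) M (5 / 56) ltac:(lra) ltac:(lra).
apply: (subset_measure0 _ _ _ (step N)); try (by apply: measurableC; exact: measurable_box).
move=> x nx bx; apply: nx; apply: box_le bx.
by have := hN N (leqnn N); rewrite ler_norml; lra.
Qed.

Lemma mu_stage n : mu (~` stage n) = 0%E.
Proof.
elim: n => [|n IH]; first exact: mu_outside_box.
rewrite mu_ss.2; last by apply: measurableC; exact: measurable_stage.
rewrite big1 // => i _; rewrite [mu _](_ : _ = 0%E) ?mule0 //.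
apply: (subset_measure0 _ _ _ IH).
- rewrite -[X in measurable X]setTI.
  by apply: (measurable_phi i) => //; (by apply: measurableC; exact: measurable_stage).
- by (by apply: measurableC; exact: measurable_stage).
- by move=> x /= nx bx; apply: nx; exists i => //; exists x.
Qed.

(** The defining identity says that mu is 1/9 times the sum of its nine pushforwards. For a
    nonnegative integrand the integral splits over such a sum, and each term is a change of
    variables. *)
Lemma int_self_similar (h : plane -> R) : bounded_measurable h ->
  (forall x, 0 <= h x) ->
  \int[mu]_x h x = 9^-1 * \sum_(i < 9) \int[mu]_x h (phi i x).
Proof.
move=> bh h0; have mh := bh.1.
have mhE : measurable_fun setT (EFin \o h) by exact/measurable_EFinP.
have fT : (mu setT < +oo)%E by rewrite probability_setT ltry.
have bhi i : bounded_measurable (fun x => h (phi i x)).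
  split; first by apply: measurableT_comp mh _; exact: measurable_phi.
  by have [M hM] := bh.2; exists M => x.
have [pf pfE pfI] : exists2 pf : 'I_9 -> {measure set plane -> \bar R},
    (forall i A, pf i A = mu (phi i @^-1` A)) &
    forall i, (\int[pf i]_x (h x)%:E = \int[mu]_x (h (phi i x))%:E)%E.
  exists (fun i => measure_function_pushforward__canonical__measure_function_Measure mu
    (measurable_phi i)) => // i.
  have hE0 : {in setT, forall y, (0 <= (EFin \o h) y)%E} by move=> y _; rewrite /= lee_fin.
  exact: (ge0_integral_pushforward (measurable_phi i) mu measurableT mhE hE0).
have c0 : 0 <= 9^-1 :> R by lra.
pose m2 := mscale (NngNum c0) (msum (fun i => pf (inord i)) 9).
have E : (\int[mu]_x (h x)%:E = \int[m2]_x (h x)%:E)%E.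
  apply: eq_measure_integral => A mA _.
  apply: (eq_trans (mu_ss.2 A mA)); rewrite /m2 /= /mscale /msum /= ge0_sume_distrr //.
  by apply: eq_bigr => i _; rewrite inord_val pfE.
have E2 : (\int[m2]_x (h x)%:E = (9^-1)%:E * \sum_(i < 9) \int[mu]_x (h (phi i x))%:E)%E.
  rewrite ge0_integral_mscale //; last by move=> x _; rewrite lee_fin.
  rewrite ge0_integral_measure_sum //; last by move=> x _; rewrite lee_fin.
  congr (_ * _)%E; apply: eq_bigr => i _.
  by rewrite pfI inord_val.
rewrite /Rintegral E E2.
have -> : (\sum_(i < 9) \int[mu]_x (h (phi i x))%:E =
    (\sum_(i < 9) \int[mu]_x h (phi i x))%:E)%E.
  rewrite -sumEFin; apply: eq_bigr => i _; rewrite /Rintegral fineK //.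
  exact: integrable_fin_num (bm_integrable measurableT fT (bhi i)).
by rewrite -EFinM.
Qed.

End SelfSimilar.

(** * Elementary estimates for the cosine *)

Lemma lipschitz1 (R : realType) (f df : R -> R) : (forall x, is_derive x (1 : R) f (df x)) ->
  (forall x, `|df x| <= 1) -> forall a b, `|f a - f b| <= `|a - b|.
Proof.
move=> fd d1 a b.
wlog ab : a b / a <= b => [H|].
  by case: (leP a b) => [/H//|/ltW /H]; rewrite distrC [leRHS]distrC.
have cf : {within `[a, b], continuous f}.
  apply: continuous_subspaceT => x; apply: differentiable_continuous.
  by apply/derivable1_diffP; have := fd x => -[].
have [c _ E] := MVT_segment ab (fun x _ => fd x) cf.
by rewrite distrC E normrM [leRHS]distrC ler_piMl.
Qed.

Lemma cos_lip (R : realType) (a b : R) : `|cos a - cos b| <= `|a - b|.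
Proof.
apply: (@lipschitz1 R cos (fun x => - sin x)) => x.
by rewrite normrN sin_max.
Qed.

Lemma cos_periodz (R : realType) (a : R) (z : int) : cos (a + 2 * pi * z%:~R) = cos a.
Proof.
have h (n : nat) b : cos (b + 2 * pi * n%:R) = cos b :> R.
  rewrite -[in RHS](periodicn (@cosD2pi R) n b); congr cos.
  by rewrite -mulr_natr -[pi *+ 2]mulr_natr; ring.
case: z => n; first by rewrite -pmulrn h.
rewrite NegzE mulrNz -pmulrn -[in RHS](subrK (2 * pi * n.+1%:R) a) h.
by congr cos; ring.
Qed.

(** * The Fourier transform of the self-similar measure *)

Section FourierTransform.
Variable R : realType.
Local Notation plane := (R * R)%type.
Variable mu : probability (R * R)%type R.
Implicit Types (x y z w v : plane) (c : R) (M N : nat).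

Lemma bm_comp_dot (g : R -> R) w : continuous g -> (forall t, `|g t| <= 1) ->
  bounded_measurable (fun x : plane => g (2 * pi * dot2 x w)).
Proof.
move=> cg g1; split; last by exists 1 => x; exact: g1.
apply: (measurableT_comp (f := g)); first exact: continuous_measurable_fun.
by apply: measurable_funM => //; exact: measurable_dot2.
Qed.

(** The real part of the Fourier transform. It satisfies a product recursion on its own because the
    digit set is symmetric about the origin. *)
Definition ft w : R := \int[mu]_x cos (2 * pi * dot2 x w).

Let bmcos w := bm_comp_dot w (@continuous_cos R) (@cos_max R).

Lemma prob_lty : (mu setT < +oo)%E.
Proof. by rewrite probability_setT ltry. Qed.

Let mT := @measurableT _ plane.

Lemma int_cst c : \int[mu]_x c = c.
Proof.
rewrite Rintegral_cst // [X in _ * fine X](_ : _ = 1%E) ?mulr1 //.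
exact: probability_setT.
Qed.

Lemma ft0 : ft 0 = 1.
Proof.
rewrite -[RHS]int_cst /ft; apply: eq_Rintegral => x _.
by rewrite /dot2 /= !mulr0 addr0 mulr0 cos0.
Qed.

Lemma norm_ft w : `|ft w| <= 1.
Proof.
have := bm_int_norm_le mT prob_lty (bmcos w) (fun x _ => cos_max (2 * pi * dot2 x w)).
by rewrite [X in _ * fine X](_ : _ = 1%E) ?mulr1 //; exact: probability_setT.
Qed.

Definition digit_ft w : R := 9^-1 * \sum_(i < 9) cos (2 * pi * dot2 (digit R i) w).

Lemma norm_digit_ft w : `|digit_ft w| <= 1.
Proof.
rewrite /digit_ft normrM ger0_norm ?invr_ge0 //.
rewrite ler_pdivrMl // (le_trans (ler_norm_sum _ _ _)) //.
rewrite (le_trans (ler_sum _ (fun i _ => cos_max _))) //.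
by rewrite sumr_const card_ord mulr1.
Qed.

Definition integer_point v := exists k l : int, v = (k%:~R, l%:~R).

Lemma digit_integer i : integer_point (digit R i).
Proof.
exists ((i %% 3)%N%:Z - 1), ((i %/ 3)%N%:Z - 1).
by rewrite /digit !intrB -!pmulrn.
Qed.

(** The digits are integer vectors too, so every phase moves by a multiple of 2 pi. *)
Lemma digit_ft_periodic v w : integer_point v -> digit_ft (v + w) = digit_ft w.
Proof.
move=> [k [l ->]]; congr (_ * _); apply: eq_bigr => i _.
have [m [n ->]] := digit_integer i.
rewrite -[in RHS](cos_periodz _ (m * k + n * l)); congr cos.
by rewrite /dot2 /= intrD !intrM; ring.
Qed.

Lemma digit_ft0 : digit_ft 0 = 1.
Proof.
rewrite /digit_ft (eq_bigr (fun=> 1)) => [|i _].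
  by rewrite sumr_const card_ord mulVf.
by rewrite /dot2 /= !mulr0 addr0 mulr0 cos0.
Qed.

(** Reversing the indices realises the symmetry of the digit set; the sine sums then cancel in
    pairs. *)
Lemma digit_rev i : digit R (rev_ord i) = - digit R i.
Proof.
by apply/eqP; case: i => -[|[|[|[|[|[|[|[|[|//]]]]]]]]] p;
  rewrite /digit /= -pair_eqE /pair_eq /=;
  apply/andP; split; apply/eqP; rewrite /divn /modn /=; ring.
Qed.

Lemma sum_sin_digit w : \sum_(i < 9) sin (2 * pi * dot2 (digit R i) w) = 0.
Proof.
set s := LHS; suff : s = - s by move=> h; lra.
rewrite {1}/s (reindex_inj rev_ord_inj) /= -sumrN; apply: eq_bigr => i _.
by rewrite -sinN digit_rev; congr sin; rewrite /dot2 /=; ring.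
Qed.

(** The power theta^M of theta = 8 + i, as a vector. *)
Definition vec M : plane := iter M (@gmul R) (1, 0).

Lemma integer_vec M : integer_point (vec M).
Proof.
elim: M => [|M [k [l E]]]; first by exists 1, 0.
rewrite /vec iterS -/(vec M) E; exists (8 * k - l), (k + 8 * l).
by rewrite /gmul /= intrB intrD !intrM.
Qed.

Lemma gdivD v w : gdiv (v + w) = gdiv v + gdiv w.
Proof. by rewrite /gdiv /=; congr pair; rewrite /=; field. Qed.

Lemma gdiv_vecS M : gdiv (vec M.+1) = vec M.
Proof. by rewrite /vec iterS gmulK. Qed.

Lemma box_iter_gdiv M c w : box c w -> box ((9 / 65) ^+ M * c) (iter M (@gdiv R) w).
Proof.
elim: M => [|M IH] bw; first by rewrite expr0 mul1r.
by rewrite iterS exprS -mulrA; apply: box_gdiv; exact: IH.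
Qed.

Hypothesis mu_ss : self_similar (@phi R) mu.

Lemma int_box (h : plane -> R) : bounded_measurable h ->
  \int[mu]_x h x = \int[mu]_(x in box (5 / 4)) h x.
Proof.
move=> bh; rewrite /Rintegral (negligible_integral (N := ~` box (5 / 4))) //.
- by rewrite setTD setCK.
- by apply: measurableC; exact: measurable_box.
- exact: (bm_integrable mT prob_lty bh).
- exact: mu_outside_box.
Qed.

Lemma mu_box_le1 : (mu (box (5 / 4)) <= 1)%E.
Proof. by apply: probability_le1; exact: measurable_box. Qed.

Lemma mu_box_lty : (mu (box (5 / 4)) < +oo)%E.
Proof. exact: le_lt_trans mu_box_le1 (ltry _). Qed.

Lemma fine_mu_box : fine (mu (box (5 / 4))) = 1.
Proof.
have := int_box (bm_cst _ 1); rewrite int_cst Rintegral_cst ?mul1r //.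
exact: measurable_box.
Qed.

(** The cosine is 1-Lipschitz, and on the box of half-side 5/4 carrying mu the phase changes by at
    most 2 pi (5/4 d + 5/4 d). *)
Lemma ft_lip d w v : box d (w - v) -> `|ft w - ft v| <= 5 * pi * d.
Proof.
move=> [/= d1 d2]; rewrite /ft -(bm_intB mT prob_lty (bmcos w) (bmcos v)).
rewrite int_box; last exact: bmB.
rewrite -[leRHS]mulr1 -[X in _ <= _ * X]fine_mu_box.
apply: bm_int_norm_le; [exact: measurable_box|exact: mu_box_lty|exact: bmB|].
move=> x [x1 x2]; apply: (le_trans (cos_lip _ _)).
have -> : 2 * pi * dot2 x w - 2 * pi * dot2 x v =
   (2 * pi) * (x.1 * (w.1 - v.1) + x.2 * (w.2 - v.2)) by rewrite /dot2; ring.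
rewrite normrM ger0_norm ?mulr_ge0 ?pi_ge0 //.
have -> : 5 * pi * d = (2 * pi) * (5 / 4 * d + 5 / 4 * d) by field.
apply: ler_wpM2l; first by rewrite mulr_ge0 ?pi_ge0.
by rewrite (le_trans (ler_normD _ _)) // !normrM lerD // ler_pM.
Qed.

(** Self-similarity followed by the addition formula for the cosine; the sine terms vanish when
    summed over the symmetric digits. *)
Lemma ft_rec w : ft w = digit_ft w * ft (gdiv w).
Proof.
(* Adding 1 gives the nonnegative integrand that [int_self_similar] requires. *)
pose h x := 1 + cos (2 * pi * dot2 x w).
have bh : bounded_measurable h by apply: bmD; [exact: bm_cst | exact: bmcos].
have h0 x : 0 <= h x by rewrite /h; have := cos_geN1 (2 * pi * dot2 x w); lra.
have := int_self_similar mu_ss bh h0.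
have -> : \int[mu]_x h x = 1 + ft w.
  by rewrite /h (bm_intD mT prob_lty (bm_cst _ 1) (bmcos w)) int_cst.
pose B (i : 'I_9) := 2 * pi * dot2 (digit R i) w.
pose S := \int[mu]_x sin (2 * pi * dot2 x (gdiv w)).
have bmsin := bm_comp_dot (gdiv w) (@continuous_sin R) (@sin_max R).
have E i : \int[mu]_x h (phi i x) = 1 + (cos (B i) * ft (gdiv w) - sin (B i) * S).
  rewrite /ft /S -!(bm_intZ mT prob_lty) // -(bm_intB mT prob_lty); try exact: bmZ.
  rewrite -[X in X + _](int_cst 1) -(bm_intD mT prob_lty); [|exact: bm_cst|by apply: bmB;
    exact: bmZ].
  apply: eq_Rintegral => x _; rewrite /h; congr (_ + _).
  by rewrite dot2_phi mulrDr cosD /B; ring.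
rewrite (eq_bigr _ (fun i _ => E i)) big_split /= sumr_const card_ord sumrB -!mulr_suml.
by rewrite sum_sin_digit mul0r subr0 => F; rewrite /digit_ft -/B; lra.
Qed.

(** [q] is the product of the first M digit factors at w. Shifting by theta^M does not change them,
    and after M divisions the shift has become (1, 0). *)
Lemma ft_vec M w : exists q, [/\ `|q| <= 1,
  ft w = q * ft (iter M (@gdiv R) w) &
  ft (vec M + w) = q * ft ((1, 0) + iter M (@gdiv R) w)].
Proof.
elim: M w => [|M IH] w; first by exists 1; rewrite normr1 !mul1r.
have [q [q1 E1 E2]] := IH (gdiv w).
exists (digit_ft w * q); split.
- by rewrite normrM mulr_ile1 // norm_digit_ft.
- by rewrite iterSr -mulrA -E1 -ft_rec.
- rewrite iterSr -mulrA -E2 ft_rec digit_ft_periodic; last exact: integer_vec.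
  by rewrite gdivD gdiv_vecS.
Qed.

(** One step of the recursion has factor 1, since (1, 0) is an integer point. At the new frequency
    (8/65, -1/65) the phases on the support are at most 2 pi (5/4)(9/65) = 9/26 pi, below pi/2. *)
Lemma ft10_gt0 : 0 < ft (1, 0).
Proof.
rewrite ft_rec -[(1, 0)]addr0 digit_ft_periodic; last by exists 1, 0.
rewrite digit_ft0 mul1r addr0.
have pi0 : 0 < pi :> R := pi_gt0 R.
apply: (@lt_le_trans _ _ (cos (9 / 26 * pi))).
  by apply: cos_gt0_pihalf; apply/andP; split; lra.
rewrite /ft int_box; last exact: bmcos.
rewrite -[leLHS]mulr1 -[X in _ * X <= _]fine_mu_box -(Rintegral_cst mu (@measurable_box R (5
  / 4))).
apply: bm_int_le; [exact: measurable_box|exact: mu_box_lty|exact: bm_cst|exact: bmcos|].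
move=> x [x1 x2]; rewrite -[leRHS]cos_norm.
have D : `|2 * pi * dot2 x (gdiv (1, 0))| <= 9 / 26 * pi.
  have -> : 9 / 26 * pi = 2 * pi * (9 / 52) :> R by field.
  rewrite normrM ger0_norm ?mulr_ge0 ?pi_ge0 //; apply: ler_wpM2l;
    first by rewrite mulr_ge0 ?pi_ge0.
  by move: x1 x2; rewrite /dot2 /gdiv /= !ler_norml; lra.
rewrite leNgt ltr_cos; [by rewrite -leNgt| |]; rewrite in_itv /= ?normr_ge0 /=; lra.
Qed.

(* The digits are integer vectors, and so is [gdiv] applied less than M times to
   [vec M]: the first M factors of the product formulas for [ft (vec M + w)] and
   [ft w] agree. *)
Lemma ft_vec_limit w (e : R) : 0 < e -> exists N, forall M v, (N <= M)%N ->
  box N.+1%:R^-1 v -> `|ft (vec M + w + v) - ft (1, 0) * ft w| <= e.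
Proof.
move=> e0; have pi0 : 0 < pi :> R := pi_gt0 R.
pose c := `|w.1| + `|w.2|.
have bw : box c w by split; rewrite /c; [rewrite lerDl|rewrite lerDr].
have [N1 h1] := @pow_small R (9 / 65) c (e / (15 * pi)) ltac:(lra) ltac:(by rewrite divr_gt0
  // mulr_gt0).
have [N2 h2] : exists N2, forall n, (N2 <= n)%N -> n.+1%:R^-1 <= e / (15 * pi).
  exists (Num.trunc (15 * pi / e)) => n hn.
  rewrite -[leRHS]invrK lef_pV2 ?posrE ?invr_gt0 ?divr_gt0 ?mulr_gt0 // invf_div.
  by apply: (le_trans (ltW (truncnS_gt _))); rewrite ler_nat.
exists (maxn N1 N2) => M v; rewrite geq_max => /andP[m1 m2] bv.
have pie : 5 * pi * (e / (15 * pi)) = e / 3.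
  suff h (p : R) : p != 0 -> 5 * p * (e / (15 * p)) = e / 3 by rewrite h // gt_eqF.
  by move=> p0; field.
have L1 : `|ft (vec M + w + v) - ft (vec M + w)| <= e / 3.
  rewrite (le_trans (@ft_lip (maxn N1 N2).+1%:R^-1 _ _ _)) //.
    by have -> : vec M + w + v - (vec M + w) = v by rewrite addrAC subrr add0r.
  by rewrite -pie ler_pM2l ?mulr_gt0 // h2 // leq_maxr.
have [q [q1 E1 E2]] := ft_vec M w.
set u := iter M _ w in E1 E2.
have bu : box (e / (15 * pi)) u.
  apply: box_le (box_iter_gdiv M bw).
  by have := h1 M m1; rewrite ler_norml => /andP[].
have L2 : `|ft ((1, 0) + u) - ft (1, 0)| <= e / 3.
  by rewrite -pie; apply: ft_lip; rewrite addrAC subrr add0r.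
have L3 : `|ft u - 1| <= e / 3.
  by rewrite -pie -[X in ft u - X]ft0; apply: ft_lip; rewrite subr0.
have -> : ft (vec M + w + v) - ft (1, 0) * ft w =
   (ft (vec M + w + v) - ft (vec M + w)) + (q * (ft ((1, 0) + u) - ft (1, 0))
    + q * (ft (1, 0) * (1 - ft u))).
  by rewrite E2 [in LHS]E1; ring.
have e3 : e = e / 3 + (e / 3 + e / 3) by field.
rewrite {}[leRHS]e3 (le_trans (ler_normD _ _)) // lerD // (le_trans (ler_normD _ _)) // lerD //.
  by rewrite normrM (le_trans _ L2) // ler_piMl.
rewrite normrM (le_trans _ L3) // (le_trans (ler_piMl _ _)) // normrM distrC.
by rewrite ler_piMl // norm_ft.
Qed.

End FourierTransform.

(** * Oscillatory integrals on an interval *)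

Lemma norm_int_cos (R : realType) (T w : R) : 0 < T -> w != 0 ->
  `|\int[lebesgue_measure]_(t in `[- T, T]) cos (w * t)| <= 2 / `|w|.
Proof.
move=> T0 w0; pose F (t : R) := w^-1 * sin (w * t).
have dF (t : R) : is_derive t (1 : R) F (cos (w * t)).
  have h1 : is_derive t (1 : R) ( *%R w) w.
    by have := is_deriveZ w (is_derive_id t (1 : R)); rewrite /GRing.scale /= mulr1.
  have h2 := is_derive1_comp (is_derive_sin (w * t)) h1.
  have := is_deriveZ w^-1 h2; congr (is_derive _ _ _ _).
  by rewrite /GRing.scale /= mulrC -mulrA divff // mulr1.
have cc : continuous (fun t : R => cos (w * t)).
  by move=> t; apply: continuous_comp; [apply: cvgM;
    [exact: cvg_cst|exact: cvg_id] | exact: continuous_cos].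
have -> : \int[lebesgue_measure]_(t in `[- T, T]) cos (w * t) = F T - F (- T).
  rewrite /Rintegral (@continuous_FTC2 _ _ F) //.
  - lra.
  - exact: continuous_subspaceT.
  - split.
    + by move=> x _; have := dF x => -[].
    + apply: cvg_at_right_filter; apply: differentiable_continuous; apply/derivable1_diffP;
      have := dF (- T) => -[] //.
    + apply: cvg_at_left_filter; apply: differentiable_continuous; apply/derivable1_diffP;
      have := dF T => -[] //.
  - by move=> x _; rewrite derive1E; have := dF x => -[].
rewrite /F -mulrBr normrM normfV mulrC ler_pM2r ?invr_gt0 ?normr_gt0 //.
by rewrite (le_trans (ler_normB _ _)) // (le_trans (lerD (sin_max _) (sin_max _))).
Qed.

(** * From weak to strong convergence of waves *)

Section WeakConvergence.
Variable R : realType.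
Local Notation plane := (R * R)%type.
Variable mu : probability (R * R)%type R.
Hypothesis mu_ss : self_similar (@phi R) mu.
Variables (u y : plane).
Hypothesis u_unit : unit_circle u.
(** The cosine ([sg] = 1) and the sine ([sg] = -1) are treated together; [gg] is their common
    product-to-sum formula. *)
Variables (g : R -> R) (sg : R).
Hypotheses (cg : continuous g) (g1 : forall t, `|g t| <= 1) (sg1 : `|sg| <= 1).
Hypothesis gg : forall a b, g a * g b = 2^-1 * (cos (a - b) + sg * cos (a + b)).
Implicit Types (x z w v : plane) (M N : nat) (S : R -> R).

Definition scl (c : R) (w : plane) : plane := (c * w.1, c * w.2).

(* The frequency vector xi u is close to the integer vector [vec M] shifted by y. *)
Definition freq (y' u' : plane) N (xi : R) :=
  exists2 M, (N <= M)%N & box N.+1%:R^-1 (scl xi u' - (vec R M + y')).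

Hypothesis u_freq : forall N, exists xi, freq y u N xi.

Lemma freq_le N N' xi : (N <= N')%N -> freq y u N' xi -> freq y u N xi.
Proof.
move=> NN' [M M1 b]; exists M; first exact: leq_trans M1.
by apply: box_le b; rewrite lef_pV2 ?posrE // ler_nat.
Qed.

Lemma dot2_scl c x w : dot2 x (scl c w) = c * dot2 x w.
Proof. by rewrite /dot2 /=; ring. Qed.

Lemma norm_vec M : (vec R M).1 ^+ 2 + (vec R M).2 ^+ 2 = 65 ^+ M.
Proof.
elim: M => [|M IH]; first by rewrite /= expr1n expr0n addr0.
by rewrite [RHS]exprS -IH /vec iterS /gmul /=; ring.
Qed.

(** As u is a unit vector, |xi| is the length of xi u, which stays within bounded distance of
    theta^M, of squared length 65^M. *)
Lemma freq_large (B : R) : exists N, forall xi, freq y u N xi -> B <= `|xi|.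
Proof.
pose c := (`|y.1| + 1) ^+ 2 + (`|y.2| + 1) ^+ 2.
have c0 : 0 <= c by rewrite addr_ge0 ?sqr_ge0.
pose N := Num.trunc (2 * (B ^+ 2 + c)).
exists N.+1 => xi [M NM [/= b1 b2]].
have h1 : N.+1%:R <= 65 ^+ M :> R.
  rewrite -natrX ler_nat (leq_trans NM) // ltnW // ltn_expl //.
have h2 : 2 * (B ^+ 2 + c) <= 65 ^+ M by apply: le_trans h1; exact: ltW (truncnS_gt _).
have i1 : N.+2%:R^-1 <= 1 :> R by rewrite invf_le1 ?ltr0n // ler1n.
have key (p q r : R) : `|p - (q + r)| <= N.+2%:R^-1 -> q ^+ 2 <= 2 * p ^+ 2 + 2 * (`|r| + 1) ^+ 2.
  move=> h; have hq : `|q| <= `|p| + (`|r| + 1).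
    have -> : q = p - (r + (p - (q + r))) by ring.
    rewrite (le_trans (ler_normB _ _)) // lerD2l (le_trans (ler_normD _ _)) // lerD2l.
    exact: le_trans i1.
  have : q ^+ 2 <= (`|p| + (`|r| + 1)) ^+ 2.
    by rewrite -[leLHS]real_normK ?num_real // ler_sqr ?nnegrE ?addr_ge0.
  rewrite -[p ^+ 2]real_normK ?num_real // => h'; apply: (le_trans h').
  rewrite -subr_ge0 (_ : _ - _ = (`|p| - (`|r| + 1)) ^+ 2) ?sqr_ge0 //; ring.
have k1 := key _ _ _ b1; have k2 := key _ _ _ b2.
have : 65 ^+ M <= 2 * xi ^+ 2 + 2 * c.
  rewrite -norm_vec /c; have : xi ^+ 2 = (xi * u.1) ^+ 2 + (xi * u.2) ^+ 2.
    by rewrite !exprMn -mulrDr u_unit mulr1.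
  by move=> ->; lra.
move=> h3; have : B ^+ 2 <= `|xi| ^+ 2 by rewrite real_normK ?num_real //; lra.
by move=> h4; rewrite leNgt; apply/negP => lt; have : `|xi| ^+ 2 < B ^+ 2;
  [rewrite ltr_sqr ?nnegrE // (le_trans (normr_ge0 xi)) // ltW | rewrite ltNge h4].
Qed.

Let b := ft mu (1, 0).
Let b0 : 0 < b := ft10_gt0 mu_ss.
Let f x := g (2 * pi * dot2 x y).
Let e (xi t : R) := g (2 * pi * (xi * t)).
Let mT := @measurableT _ plane.
Let fin := prob_lty mu.
Let bmg w := bm_comp_dot w cg g1.

Lemma bm_wave xi : bounded_measurable (e xi).
Proof.
split; last by exists 1 => t; exact: g1.
apply: continuous_measurable_fun => t; apply: continuous_comp; last exact: cg.
by do 2 (apply: cvgM; first exact: cvg_cst); exact: cvg_id.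
Qed.

Lemma bm_proj S : bounded_measurable S -> bounded_measurable (fun x : plane => S (dot2 x u)).
Proof.
move=> [mS [B SB]]; split; last by exists B.
by apply: measurableT_comp mS _; exact: measurable_dot2.
Qed.

Lemma waveE xi x : e xi (dot2 x u) = g (2 * pi * dot2 x (scl xi u)).
Proof. by rewrite dot2_scl. Qed.

Lemma int_gg v w : \int[mu]_x (g (2 * pi * dot2 x v) * g (2 * pi * dot2 x w)) =
  2^-1 * (ft mu (v - w) + sg * ft mu (v + w)).
Proof.
have bc z := bm_comp_dot z (@continuous_cos R) (@cos_max R).
rewrite /ft -(bm_intZ mT fin sg (bc _)) -(bm_intD mT fin (bc _)); last exact: bmZ.
rewrite -(bm_intZ mT fin); last by apply: bmD => //; exact: bmZ.
apply: eq_Rintegral => x _; rewrite gg; congr (_ * (_ + _ * _)); congr cos; rewrite /dot2 /=;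
  ring.
Qed.

(** By the product-to-sum formula the integral combines the two differences between [ft] at xi u -+
    w and b times [ft] at y -+ w; both tend to 0 by [ft_vec_limit]. *)
Lemma weak_wave w (d : R) : 0 < d -> exists N, forall xi, freq y u N xi ->
  `|\int[mu]_x (g (2 * pi * dot2 x w) * (e xi (dot2 x u) - b * f x))| <= d.
Proof.
move=> d0.
have [N1 h1] := ft_vec_limit mu_ss (y - w) d0.
have [N2 h2] := ft_vec_limit mu_ss (y + w) d0.
exists (maxn N1 N2) => xi fxi.
have [M1 M1n b1] := freq_le (leq_maxl N1 N2) fxi.
have [M2 M2n b2] := freq_le (leq_maxr N1 N2) fxi.
have := h1 _ _ M1n b1; have := h2 _ _ M2n b2; rewrite -/b.
have -> : vec R M2 + (y + w) + (scl xi u - (vec R M2 + y)) = scl xi u + w.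
  by apply/eqP; rewrite -pair_eqE /pair_eq /=; apply/andP; split; apply/eqP; rewrite /=; ring.
have -> : vec R M1 + (y - w) + (scl xi u - (vec R M1 + y)) = scl xi u - w.
  by apply/eqP; rewrite -pair_eqE /pair_eq /=; apply/andP; split; apply/eqP; rewrite /=; ring.
move=> l2 l1.
have -> : \int[mu]_x (g (2 * pi * dot2 x w) * (e xi (dot2 x u) - b * f x)) =
   2^-1 * ((ft mu (scl xi u - w) - b * ft mu (y - w)) + sg * (ft mu (scl xi u + w) - b * ft
     mu (y + w))).
  transitivity (\int[mu]_x (g (2 * pi * dot2 x (scl xi u)) * g (2 * pi * dot2 x w)
     - b * (g (2 * pi * dot2 x y) * g (2 * pi * dot2 x w)))).
    by apply: eq_Rintegral => x _; rewrite waveE /f; ring.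
  rewrite (bm_intB mT fin); [|exact: bmM|by apply: bmZ; exact: bmM].
  by rewrite (bm_intZ mT fin); [rewrite !int_gg; ring | exact: bmM].
set p := _ - b * _ in l1 *; set q := _ - b * _ in l2 *.
rewrite normrM ger0_norm ?invr_ge0 // ler_pdivrMl // (le_trans (ler_normD _ _)) //.
have : `|sg * q| <= d by rewrite normrM (le_trans _ l2) // ler_piMl.
by rewrite -/p -/q; lra.
Qed.

Variable T : R.
Hypothesis T0 : 0 < T.
Let D : set R := `[- T, T]%classic.
Local Notation leb := (@lebesgue_measure R).

Lemma meas_D : measurable D.
Proof. exact: measurable_itv. Qed.

Lemma leb_D : leb D = (2 * T)%:E.
Proof.
have TT : - T < T by apply: (@lt_trans _ _ 0); rewrite ?oppr_lt0.
rewrite /D lebesgue_measure_itv /= lte_fin TT.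
by rewrite -EFinD; congr EFin; ring.
Qed.

Lemma leb_D_lty : (leb D < +oo)%E.
Proof. by rewrite leb_D ltry. Qed.

Let lebZ := @bm_intZ _ _ R leb D meas_D leb_D_lty.
Let lebD := @bm_intD _ _ R leb D meas_D leb_D_lty.
Let leb_norm := @bm_int_norm_le _ _ R leb D meas_D leb_D_lty.
Let leb_mix := @bm_int_mix _ _ R leb D meas_D leb_D_lty.

Lemma leb_weak_wave xi' (d : R) : 0 < d -> exists N, forall xi, freq y u N xi ->
  `|\int[leb]_(t in D) (e xi' t * e xi t)| <= d.
Proof.
(* This threshold keeps both frequencies xi' - xi and xi' + xi of the product above 1/d in absolute
   value, where the cosine integrals are at most d. *)
move=> d0; have [N hN] := freq_large (`|xi'| + d^-1).
exists N => xi /hN L.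
have pi2 : 2 <= pi :> R := pi_ge2 R.
have cw (w : R) : continuous (fun t : R => cos (w * t)).
  by move=> t; apply: continuous_comp; [apply: cvgM;
    [exact: cvg_cst|exact: cvg_id] | exact: continuous_cos].
have bc (w : R) : bounded_measurable (fun t : R => cos (w * t)).
  by split; [exact: continuous_measurable_fun | exists 1 => t; exact: cos_max].
have -> : \int[leb]_(t in D) (e xi' t * e xi t) =
   2^-1 * (\int[leb]_(t in D) cos (2 * pi * (xi' - xi) * t) + sg * \int[leb]_(t in D) cos (2
     * pi * (xi' + xi) * t)).
  have bc1 := bc (2 * pi * (xi' - xi)); have bc2 := bmZ sg (bc (2 * pi * (xi' + xi))).
  rewrite -(lebZ sg (bc (2 * pi * (xi' + xi)))) -(lebD bc1 bc2) -(lebZ 2^-1 (bmD bc1 bc2)).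
  by apply: eq_Rintegral => t _; rewrite /e gg; congr (_ * (_ + _ * _)); congr cos; ring.
have bound (w : R) : d^-1 <= `|w| -> `|\int[leb]_(t in D) cos (2 * pi * w * t)| <= d.
  move=> wd; have w0 : 0 < `|w| by rewrite (lt_le_trans _ wd) // invr_gt0.
  have w00 : w != 0 by move: w0; rewrite normr_gt0.
  have pw0 : 2 * pi * w != 0.
    by apply: mulf_neq0 => //; apply: mulf_neq0; rewrite ?pnatr_eq0 // gt_eqF // pi_gt0.
  apply: (le_trans (norm_int_cos T0 pw0)).
  rewrite ler_pdivrMr ?normr_gt0 // normrM [`|2 * pi|]ger0_norm ?mulr_ge0 ?pi_ge0 //.
  have : 1 <= d * `|w| by rewrite -ler_pdivrMl // mulr1.
  by move=> h; rewrite mulrCA; nra.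
have b1 : d^-1 <= `|xi' - xi|.
  by have := ler_normB xi' (xi' - xi); rewrite opprB addrCA subrr addr0; lra.
have b2 : d^-1 <= `|xi' + xi|.
  by have := ler_normB (xi' + xi) xi'; rewrite addrAC subrr add0r; lra.
have B1 := bound _ b1; have B2 := bound _ b2.
set p := Rintegral _ _ _ in B1 *; set q := Rintegral _ _ _ in B2 *.
rewrite normrM ger0_norm ?invr_ge0 // ler_pdivrMl // (le_trans (ler_normD _ _)) //.
have : `|sg * q| <= d by rewrite normrM (le_trans _ B2) // ler_piMl.
by lra.
Qed.

(* [b^-1 * e xi] tends weakly to [f] in L^2(mu) and to 0 in L^2([-T, T]) as
   [xi] runs through the frequencies provided by [u_freq]; convex combinations
   of them converge strongly in both spaces. *)
Lemma strong_approx (d : R) : 0 < d -> exists S, [/\ bounded_measurable S,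
  \int[mu]_x ((S (dot2 x u) - f x) ^+ 2) <= d &
  \int[leb]_(t in D) (S t ^+ 2) <= d].
Proof.
move=> d0.
have bf : bounded_measurable f by exact: bmg.
have bv S : bounded_measurable S -> bounded_measurable (fun x : plane => S (dot2 x u) - f x).
  by move=> bS; apply: bmB => //; exact: bm_proj.
(* [A] collects the functions asymptotically orthogonal, in both spaces, to the difference between a
   wave and its weak limit. [Q] below adds the forms of the two spaces: its diagonal is the squared
   distance to f in L^2(mu) plus that to 0 in L^2([-T, T]). *)
pose A S := bounded_measurable S /\ forall d : R, 0 < d -> exists N, forall xi, freq y u N xi ->
   `|\int[mu]_x (S (dot2 x u) * (e xi (dot2 x u) - b * f x))| <= d /\
   `|\int[leb]_(t in D) (S t * e xi t)| <= d.
pose mix (t : R) S S' := fun s : R => (1 - t) * S s + t * S' s.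
pose Q S S' := \int[mu]_x ((S (dot2 x u) - f x) * (S' (dot2 x u) - f x))
   + \int[leb]_(t in D) (S t * S' t).
(* A bound for [Q] on a normalised wave: |W - f| <= 1/b + 1 on a probability space, and |W| <= 1/b
   on an interval of length 2 T. *)
pose B := (b^-1 + 1) ^+ 2 + b^-1 ^+ 2 * (2 * T).
have bi0 : 0 < b^-1 by rewrite invr_gt0.
have B0 : 0 < B by rewrite addr_gt0 // ?mulr_gt0 ?exprn_gt0 //; lra.
pose W xi := fun t : R => b^-1 * e xi t.
have bW xi : bounded_measurable (W xi) by apply: bmZ; exact: bm_wave.
have bE xi : bounded_measurable (fun x : plane => e xi (dot2 x u) - b * f x).
  by apply: bmB; [apply: bm_proj; exact: bm_wave | exact: bmZ].
have AW xi : A (W xi).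
  split=> // d' d'0; have db : 0 < b * d' by rewrite mulr_gt0.
  have [N1 h1] := weak_wave (scl xi u) db.
  have [N2 h2] := leb_weak_wave xi db.
  exists (maxn N1 N2) => xi' fx; split.
  - have := h1 _ (freq_le (leq_maxl _ _) fx).
    rewrite -ler_pdivrMl // -[b^-1]ger0_norm ?(ltW bi0) // -normrM -(bm_intZ mT fin);
      last exact: bmM.
    by congr (`|_| <= _); apply: eq_Rintegral => x _; rewrite /W -waveE; ring.
  - have := h2 _ (freq_le (leq_maxr _ _) fx).
    rewrite -ler_pdivrMl // -[b^-1]ger0_norm ?(ltW bi0) // -normrM -lebZ; last by apply: bmM;
      exact: bm_wave.
    by congr (`|_| <= _); apply: eq_Rintegral => x _; rewrite /W; ring.
have QW xi : Q (W xi) (W xi) <= B.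
  have eb t : `|W xi t| <= b^-1.
    by rewrite /W normrM ger0_norm ?(ltW bi0) // ler_piMr ?(ltW bi0) //; exact: g1.
  rewrite /Q /B lerD //.
  - have := @bm_int_norm_le _ _ _ mu _ mT fin ((b^-1 + 1) ^+ 2) _ (bmM (bv _ (bW xi)) (bv _
    (bW xi))).
    rewrite [X in _ * fine X](_ : _ = 1%E) ?mulr1; last exact: probability_setT.
    move=> h; apply: (le_trans (ler_norm _)); apply: h => x _.
    have hb : `|W xi (dot2 x u) - f x| <= b^-1 + 1.
      by rewrite (le_trans (ler_normB _ _)) // lerD //; exact: g1.
    by rewrite normrM -expr2 ler_sqr ?nnegrE ?addr_ge0 // ltW.
  - have := @leb_norm (b^-1 ^+ 2) _ (bmM (bW xi) (bW xi)).
    rewrite [X in _ * fine X](_ : _ = (2 * T)%:E) /=; last exact: leb_D.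
    move=> h; apply: (le_trans (ler_norm _)); apply: h => x _.
    by rewrite normrM -expr2 ler_sqr ?nnegrE // ltW.
have [S [[bS _] QS]] : exists S, A S /\ Q S S <= d.
  apply: (@small_quadratic_form R _ A mix Q B B0) d0.
  - by have [xi _] := u_freq 0; exists (W xi).
  - move=> t S S' [bS hS] [bS' hS']; split; first by apply: bmD; exact: bmZ.
    move=> d' d'0; pose c := `|1 - t| + `|t| + 1.
    have c0 : 0 < c by rewrite /c ltr_wpDl // addr_ge0.
    have [N1 h1] := hS _ (divr_gt0 d'0 c0).
    have [N2 h2] := hS' _ (divr_gt0 d'0 c0).
    exists (maxn N1 N2) => xi fx.
    have [l1 l2] := h1 _ (freq_le (leq_maxl _ _) fx).
    have [l3 l4] := h2 _ (freq_le (leq_maxr _ _) fx).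
    have comb (p q : R) : `|p| <= d' / c -> `|q| <= d' / c -> `|(1 - t) * p + t * q| <= d'.
      move=> pp qq; rewrite (le_trans (ler_normD _ _)) // !normrM.
      have dc : 0 <= d' / c by rewrite divr_ge0 // ltW.
      apply: (@le_trans _ _ (c * (d' / c))); last by rewrite mulrCA divff ?mulr1 // gt_eqF.
      rewrite /c 2!mulrDl mul1r -[leLHS]addr0 lerD // lerD // ler_wpM2l //.
    split.
    + have := comb _ _ l1 l3; rewrite -!(bm_intZ mT fin); try by apply: bmM => //; exact: bm_proj.
      rewrite -(bm_intD mT fin); try by apply: bmZ; apply: bmM => //; exact: bm_proj.
      by congr (`|_| <= _); apply: eq_Rintegral => x _; rewrite /mix; ring.
    + have be := bm_wave xi.
      have := comb _ _ l2 l4; rewrite -!(lebZ); try exact: bmM.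
      rewrite -(lebD); try by apply: bmZ; exact: bmM.
      by congr (`|_| <= _); apply: eq_Rintegral => x _; rewrite /mix; ring.
  - move=> t S S' [bS _] [bS' _]; rewrite /Q.
    have := bm_int_mix mT fin t (bv _ bS) (bv _ bS').
    have := leb_mix t bS bS'.
    rewrite (_ : \int[mu]_x (((1 - t) * _ + _) * _) = \int[mu]_x ((mix t S S' (dot2 x u) - f
      x) * (mix t S S' (dot2 x u) - f x))); last first.
      by apply: eq_Rintegral => x _; rewrite /mix; ring.
    by move=> E1 E2; rewrite E2 -/(mix t S S') E1; ring.
  - move=> S d' [bS hS] d'0; pose d3 := b * d' / 3.
    have d30 : 0 < d3 by rewrite divr_gt0 // mulr_gt0.
    have [N1 h1] := hS _ d30.
    have [N2 h2] := weak_wave y d30.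
    have [xi fx] := u_freq (maxn N1 N2).
    have [l1 l2] := h1 _ (freq_le (leq_maxl _ _) fx).
    have l3 := h2 _ (freq_le (leq_maxr _ _) fx).
    exists (W xi); split => //.
    (* Since e/b - f = (e - b f)/b, the cross term splits into three pairings, each small for large
       frequencies. *)
    have -> : Q S (W xi) = b^-1 * (\int[mu]_x (S (dot2 x u) * (e xi (dot2 x u) - b * f x))
       - \int[mu]_x (g (2 * pi * dot2 x y) * (e xi (dot2 x u) - b * f x))
       + \int[leb]_(t in D) (S t * e xi t)).
      have bSP := bm_proj bS; have be := bm_wave xi.
      rewrite /Q mulrDr -(bm_intB mT fin); [|exact: bmM|exact: bmM].
      rewrite -(bm_intZ mT fin); last by apply: bmB; exact: bmM.
      rewrite -lebZ; last exact: bmM.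
      congr (_ + _); apply: eq_Rintegral => x _; rewrite /W; last by ring.
      by rewrite /f; field; rewrite gt_eqF.
    rewrite ler_pdivrMl // (le_trans (ler_norm _)) // (le_trans (ler_normD _ _)) //.
    rewrite (_ : b * d' = d3 + d3 + d3); last by rewrite /d3; field.
    by rewrite lerD // (le_trans (ler_normB _ _)) // lerD.
have sq1 : 0 <= \int[mu]_x ((S (dot2 x u) - f x) ^+ 2) by apply: Rintegral_ge0 => x _;
  exact: sqr_ge0.
have sq2 : 0 <= \int[leb]_(t in D) (S t ^+ 2) by apply: Rintegral_ge0 => x _; exact: sqr_ge0.
have QS' : \int[mu]_x ((S (dot2 x u) - f x) ^+ 2) + \int[leb]_(t in D) (S t ^+ 2) <= d := QS.
by exists S; split => //; apply: le_trans QS'; rewrite ?lerDl ?lerDr.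
Qed.

End WeakConvergence.

(** * The Borel-Cantelli lemma *)

Section BorelCantelli.
Context d (X : measurableType d) (R : realType) (m : {measure set X -> \bar R}).

Lemma measurable_lim_sup (F : nat -> set X) : (forall k, measurable (F k)) ->
  measurable (lim_sup_set F).
Proof. by move=> mF; apply: bigcapT_measurable => n; apply: bigcup_measurable. Qed.

Lemma lim_sup_null (F : nat -> set X) : (forall k, measurable (F k)) ->
  (forall k, (m (F k) <= (1 / (2 ^ k.+1)%:R)%:E)%E) -> m (lim_sup_set F) = 0%E.
Proof.
move=> mF hF; apply: lim_sup_set_cvg0 => //.
apply: (@le_lt_trans _ _ 1%:E); last exact: ltry.
apply: (@le_trans _ _ (\sum_(i <oo) (1 / (2 ^ i.+1)%:R)%:E)%E).
  exact: lee_nneseries.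
exact: epsilon_trick0.
Qed.

Lemma lim_supC (F : nat -> set X) x : ~ lim_sup_set F x ->
  exists n, forall j, (n <= j)%N -> ~ F j x.
Proof.
move=> h; apply: contrapT => H; apply: h => n _; apply: contrapT => H'.
by apply: H; exists n => j nj Fj; apply: H'; exists j.
Qed.

End BorelCantelli.

(** * Singular projections and one-point slices *)

Section TypicalDirections.
Variable R : realType.
Local Notation plane := (R * R)%type.
Variable mu : probability (R * R)%type R.
Hypothesis mu_ss : self_similar (@phi R) mu.
Implicit Types (x y u : plane).

Lemma cos_cos (a b : R) : cos a * cos b = 2^-1 * (cos (a - b) + 1 * cos (a + b)).
Proof. by rewrite cosB cosD; field. Qed.

Lemma sin_sin (a b : R) : sin a * sin b = 2^-1 * (cos (a - b) + (- 1) * cos (a + b)).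
Proof. by rewrite cosB cosD; field. Qed.

Lemma unit_circle_norm u : unit_circle u -> `|u.1| <= 1 /\ `|u.2| <= 1.
Proof.
rewrite /unit_circle /= => h.
by split; rewrite -(@ler_sqr R) ?nnegrE // expr1n real_normK ?num_real // -h ?lerDl ?lerDr
  ?sqr_ge0.
Qed.

Lemma dot2_box u x : unit_circle u -> box (5 / 4) x -> `|dot2 x u| <= 3.
Proof.
move=> /unit_circle_norm[u1 u2] [x1 x2]; rewrite /dot2 (le_trans (ler_normD _ _)) // !normrM.
have h (p q : R) : 0 <= p -> p <= 5 / 4 -> 0 <= q -> q <= 1 -> p * q <= 5 / 4 by nra.
have := h _ _ (normr_ge0 x.1) x1 (normr_ge0 u.1) u1.
by have := h _ _ (normr_ge0 x.2) x2 (normr_ge0 u.2) u2; lra.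
Qed.

(** For y = 0 the target is the constant 1: some S_j tend rapidly to 1 along the projection of mu
    and to 0 in L^2([-3, 3]). By Chebyshev and Borel-Cantelli the points with |S_j| >= 1/2
    infinitely often form a Lebesgue null set that carries the projection. *)
Lemma singular_projection u : unit_circle u -> (forall N, exists xi, freq 0 u N xi) ->
  singular_leb (proj_measure mu u).
Proof.
move=> u1 ufr.
(* The interval [-3, 3] contains the projection of the box carrying mu. *)
have T0 : 0 < 3 :> R by [].
have s1 : `|1| <= 1 :> R by rewrite normr1.
have app := strong_approx mu_ss u1 (@continuous_cos R) (@cos_max R) s1 cos_cos ufr T0.
(* The factor 4 compensates the squared Chebyshev threshold 1/2, leaving the summable bound
   2^-(j+1). *)
have dj0 j : 0 < (4 * (2 ^ j.+1)%:R)^-1 :> R by rewrite invr_gt0 mulr_gt0 // ltr0n expn_gt0.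
have [S hS] := choice (fun j => app _ (dj0 j)).
have h2 : 0 < 2^-1 :> R by rewrite invr_gt0.
have quarter j : (4 * (2 ^ j.+1)%:R)^-1 / 2^-1 ^+ 2 = 1 / (2 ^ j.+1)%:R :> R.
  by field; rewrite pnatr_eq0 -lt0n expn_gt0.
pose B j : set R := `[- 3, 3]%classic `&` [set t : R | 2^-1 <= `|S j t|].
pose C j := setT `&` [set x : plane | 2^-1 <= `|S j (dot2 x u) - cos (2 * pi * dot2 x 0)|].
have bmC j : bounded_measurable (fun x : plane => S j (dot2 x u) - cos (2 * pi * dot2 x 0)).
  have [bS _ _] := hS j.
  by apply: bmB; [exact: bm_proj | exact: (bm_comp_dot 0 (@continuous_cos R) (@cos_max R))].
have mge d (X : measurableType d) (h : X -> R) : measurable_fun setT h ->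
  measurable [set t | 2^-1 <= `|h t|].
  move=> mh; rewrite -[X in measurable X]setTI.
  have -> : [set t | 2^-1 <= `|h t|] = (Num.norm \o h) @^-1` `[2^-1, +oo[.
    by apply/seteqP; split => x /=; rewrite in_itv /= andbT.
  by apply: measurableT_comp.
have mB j : measurable (B j).
  by apply: measurableI; [exact: measurable_itv | apply: mge; have [[]] := hS j].
have mC j : measurable (C j) by apply: measurableI => //; apply: mge; exact: (bmC j).1.
have CE x : cos (2 * pi * dot2 x 0) = 1 :> R by rewrite /dot2 /= !mulr0 addr0 mulr0 cos0.
have nB : lebesgue_measure (lim_sup_set B) = 0%E.
  apply: lim_sup_null => // j; have [bS _ l2] := hS j.
  have ch := @bm_chebyshev _ _ R lebesgue_measure _ (meas_D 3) (leb_D_lty T0) 2^-1 _ bS h2.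
  apply: (le_trans ch).
  by rewrite lee_fin -quarter ler_pM2r // invr_gt0 exprn_gt0.
have nC : mu (lim_sup_set C) = 0%E.
  apply: lim_sup_null => // j; have [_ l1 _] := hS j.
  apply: (le_trans (bm_chebyshev measurableT (prob_lty mu) (bmC j) h2)).
  by rewrite lee_fin -quarter ler_pM2r // invr_gt0 exprn_gt0.
exists (lim_sup_set B); split => //; first exact: measurable_lim_sup.
have mnB : measurable (~` lim_sup_set B) by apply: measurableC; exact: measurable_lim_sup.
apply: (@subset_measure0 _ _ _ mu _ (~` box (5 / 4) `|` lim_sup_set C)).
- rewrite -[X in measurable X]setTI; exact: (measurable_dot2 u).
- apply: measurableU; last exact: measurable_lim_sup.
  by apply: measurableC; exact: measurable_box.
- move=> x /= nBx; apply: contrapT => /not_orP[/contrapT bx /lim_supC[n hn]].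
  apply: nBx => k _; exists (maxn n k); first exact: leq_maxr.
  split.
    have := dot2_box u1 bx; by rewrite ler_norml /= in_itv.
  have := hn _ (leq_maxl n k); rewrite /C /= CE => H.
  have {}H : `|S (maxn n k) (dot2 x u) - 1| < 2^-1.
    by rewrite ltNge; apply/negP => H'; apply: H.
  move: H; rewrite ltr_norml ler_normr => /andP[H _]; apply/orP; left; lra.
- by apply: null_set_setU => //; [apply: measurableC;
  exact: measurable_box | exact: measurable_lim_sup | exact: mu_outside_box].
Qed.

(** Off a null set the sine is the pointwise limit of functions S_j of the projection, so it takes
    equal values at points with equal projections. *)
Lemma determined_by_projection u y : unit_circle u -> (forall N, exists xi, freq y u N xi) ->
  exists N, [/\ measurable N, mu N = 0%E & forall x x', ~ N x -> ~ N x' ->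
    dot2 x u = dot2 x' u -> sin (2 * pi * dot2 x y) = sin (2 * pi * dot2 x' y)].
Proof.
move=> u1 ufr.
have T0 : 0 < 1 :> R by [].
have s1 : `|- 1| <= 1 :> R by rewrite normrN1.
have app := strong_approx mu_ss u1 (@continuous_sin R) (@sin_max R) s1 sin_sin ufr T0.
have aj0 j : 0 < j.+1%:R^-1 :> R by rewrite invr_gt0.
(* Chebyshev at the shrinking threshold 1/(j+1) turns this error into 2^-(j+1). *)
have dj0 j : 0 < j.+1%:R^-1 ^+ 2 / (2 ^ j.+1)%:R :> R.
  by rewrite divr_gt0 ?exprn_gt0 // ltr0n expn_gt0.
have [S hS] := choice (fun j => app _ (dj0 j)).
pose C j := setT `&` [set x : plane | j.+1%:R^-1 <= `|S j (dot2 x u) - sin (2 * pi * dot2 x y)|].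
have bmC j : bounded_measurable (fun x : plane => S j (dot2 x u) - sin (2 * pi * dot2 x y)).
  have [bS _ _] := hS j.
  by apply: bmB; [exact: bm_proj | exact: (bm_comp_dot y (@continuous_sin R) (@sin_max R))].
have mC j : measurable (C j).
  apply: measurableI => //; rewrite -[X in measurable X]setTI; have mh := (bmC j).1.
  have -> : [set x : plane | j.+1%:R^-1 <= `|S j (dot2 x u) - sin (2 * pi * dot2 x y)|] =
     (Num.norm \o (fun x : plane => S j (dot2 x u) - sin (2 * pi * dot2 x y))) @^-1`
       `[j.+1%:R^-1, +oo[.
    by apply/seteqP; split => x /=; rewrite in_itv /= andbT.
  by apply: measurableT_comp.
exists (lim_sup_set C); split; first exact: measurable_lim_sup.
  apply: lim_sup_null => // j; have [_ l1 _] := hS j.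
  apply: (le_trans (bm_chebyshev measurableT (prob_lty mu) (bmC j) (aj0 j))).
  rewrite lee_fin ler_pdivrMr ?exprn_gt0 // (le_trans l1) //.
  by rewrite mulrC mul1r.
move=> x x' /lim_supC[n hn] /lim_supC[n' hn'] xx'.
apply/eqP; apply: contraT; rewrite -subr_eq0 -normr_gt0; set e := `|_| => e0.
pose k := Num.trunc (2 / e).
pose j := maxn k (maxn n n').
have h1 := hn j (leq_trans (leq_maxl n n') (leq_maxr _ _)).
have h2 := hn' j (leq_trans (leq_maxr n n') (leq_maxr _ _)).
have {}h1 : `|S j (dot2 x u) - sin (2 * pi * dot2 x y)| < j.+1%:R^-1.
  by rewrite ltNge; apply/negP => H; apply: h1.
have {}h2 : `|S j (dot2 x' u) - sin (2 * pi * dot2 x' y)| < j.+1%:R^-1.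
  by rewrite ltNge; apply/negP => H; apply: h2.
have je : j.+1%:R^-1 <= e / 2.
  rewrite -[leRHS]invrK lef_pV2 ?posrE ?invr_gt0 ?divr_gt0 // invf_div.
  by apply: (le_trans (ltW (truncnS_gt _))); rewrite ler_nat ltnS leq_maxl.
have h3 : e < j.+1%:R^-1 + j.+1%:R^-1.
  apply: le_lt_trans (ltrD h1 h2);
    rewrite /e -xx' (distrC (S j (dot2 x u)) (sin (2 * pi * dot2 x y))).
  exact: ler_distD.
by have := lt_le_trans h3 (lerD je je); rewrite -splitr ltxx.
Qed.

(** The sines of 2 pi x_1 / 8 and 2 pi x_2 / 8 determine x on the support, so the projection is
    injective off a null set N. Almost every conditional measure gives N mass 0 and is therefore
    carried by at most one point. *)
Lemma discrete_slices u : unit_circle u ->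
  (forall N, exists xi, freq (8^-1, 0) u N xi) ->
  (forall N, exists xi, freq (0, 8^-1) u N xi) ->
  forall nu, is_disintegration mu u nu -> {ae mu, forall x, discrete_measure (nu x)}.
Proof.
move=> u1 fr1 fr2 nu [nu_fiber nu_cond].
have [N1 [mN1 N10 H1]] := determined_by_projection u1 fr1.
have [N2 [mN2 N20 H2]] := determined_by_projection u1 fr2.
pose N := (~` box (5 / 4) `|` N1) `|` N2.
have mbox : measurable (~` @box R (5 / 4)) by apply: measurableC; exact: measurable_box.
have mN : measurable N by apply: measurableU => //; exact: measurableU.
have N0 : mu N = 0%E.
  apply: null_set_setU => //; first exact: measurableU.
  by apply: null_set_setU => //; exact: mu_outside_box.
have pi0 : 0 < pi :> R := pi_gt0 R.
have sininj (a b : R) : `|a| <= 5 / 4 -> `|b| <= 5 / 4 ->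
  sin (2 * pi * (a / 8)) = sin (2 * pi * (b / 8)) -> a = b.
  move=> a1 b1 /sin_inj h.
  (* The phases are at most 5 pi / 16, inside the interval where the sine is injective. *)
  have I (c : R) : `|c| <= 5 / 4 -> 2 * pi * (c / 8) \in `[- (pi / 2), pi / 2].
    by rewrite ler_norml in_itv /= => /andP[c1 c2]; apply/andP; split; nra.
  have := h (I _ a1) (I _ b1) => E.
  have pin : pi != 0 :> R by rewrite gt_eqF.
  have : (2 * pi) * (a / 8 - b / 8) = 0 by rewrite mulrBr E subrr.
  move/eqP; rewrite mulf_eq0 mulf_eq0 pnatr_eq0 /= (negbTE pin) /= => /eqP; lra.
have inj x x' : ~ N x -> ~ N x' -> dot2 x u = dot2 x' u -> x = x'.
  move=> /not_orP[/not_orP[/contrapT [a1 a2] n1] n2] /not_orP[/not_orP[/contrapT [b1 b2] m1]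
    m2] E.
  have := H1 _ _ n1 m1 E; have := H2 _ _ n2 m2 E;
    rewrite /dot2 /= !mulr0 add0r addr0 add0r addr0 => E2 E1.
  by case: x x' a1 a2 b1 b2 E1 E2 {n1 n2 m1 m2 E} => p q [r s] /= a1 a2 b1 b2 E1 E2;
    congr pair; exact: sininj.
have bN : exists M, forall y, `|\1_N y : R| <= M.
  by exists 1 => y; rewrite indicE; case: (_ \in _); rewrite ?normr1 ?normr0.
have mIN : measurable_fun setT (\1_N : plane -> R) by exact: measurable_indic.
have [g [mg ig gB gae]] := nu_cond _ mIN bN.
(* Here g(<x, u>) is the conditional expectation of the indicator of N. Its integral over the set
   where it is positive is at most mu(N) = 0, so it is almost everywhere nonpositive. *)
pose P : set R := [set t | 0 < g t].
have mP : measurable P.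
  rewrite -[X in measurable X]setTI.
  have -> : P = g @^-1` `]0, +oo[ by apply/seteqP; split => t /=; rewrite in_itv /= andbT.
  exact: mg.
pose D := (fun x => dot2 x u) @^-1` P.
have mD : measurable D by rewrite -[X in measurable X]setTI; exact: (measurable_dot2 u).
have int0 : (\int[mu]_(x in D) (g (dot2 x u))%:E = 0)%E.
  rewrite -(gB _ mP) integral_indic //.
  apply: (@subset_measure0 _ _ _ mu _ N) => //; exact: measurableI.
have gle0 : {ae mu, forall x, g (dot2 x u) <= 0}.
  have mgD : measurable_fun D (fun x => (g (dot2 x u))%:E).
    apply/measurable_EFinP; apply: measurable_funTS; apply: measurableT_comp mg _;
      exact: measurable_dot2.
  have : ae_eq mu D (fun x => (g (dot2 x u))%:E) (cst 0%E).
    apply/(ae_eq_integral_abs mu mD mgD); rewrite -[RHS]int0.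
    by apply: eq_integral => x; rewrite inE /D /P /= => gx; rewrite ger0_norm // ltW.
  apply: filterS => x; rewrite /D /P /= => h; rewrite leNgt; apply/negP => gx.
  by have := h gx => -[gx0]; rewrite gx0 ltxx in gx.
apply: filterS2 gae gle0 => x; rewrite integral_indic // setIT => nuN gx.
have nuN0 : nu x N = 0%E.
  by apply/eqP; rewrite eq_le measure_ge0 andbT nuN lee_fin.
exists (~` N `&` [set y | dot2 y u = dot2 x u]); split.
  have [[z Cz]|] := pselect (~` N `&` [set y | dot2 y u = dot2 x u] !=set0); last first.
    by move=> /set0P/negP/negPn/eqP ->; exact: countable0.
  rewrite (_ : _ `&` _ = [set z]); first exact: countable1.
  by apply/seteqP; split => [w [Nw wx]|w ->//]; case: Cz => Nz zx; apply: inj => //;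
    rewrite wx zx.
have mF : measurable [set y | dot2 y u != dot2 x u].
  rewrite -[X in measurable X]setTI.
  have -> : [set y | dot2 y u != dot2 x u] = (fun y => dot2 y u) @^-1` (~` [set dot2 x u]).
    by apply/seteqP; split => y /= /eqP.
  by apply: (measurable_dot2 u) => //; exact: measurableC.
rewrite setCI setCK (_ : ~` _ = [set y | dot2 y u != dot2 x u]); last first.
  by apply/seteqP; split => y /= /eqP.
by apply: null_set_setU => //; exact: nu_fiber.
Qed.

End TypicalDirections.

(** * Density of the frequency directions *)

Section IrrationalRotation.
Variable R : realType.
Implicit Types (a t e d : R).

(** Adding an integer l of the sign of d makes (t + l)/d nonnegative; j is then its integer part. *)
Lemma int_multiple_near d t : d != 0 ->
  exists (j : nat) (l : int), `|j%:R * d - t - l%:~R| <= `|d|.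
Proof.
move=> d0.
have [l h] : exists l : int, 0 <= (t + l%:~R) / d.
  pose n := (Num.trunc `|t|).+1.
  have tl : `|t| <= n%:R by exact: ltW (truncnS_gt _).
  have [dp|dn|d00] := ltrgt0P d; last by rewrite d00 eqxx in d0.
  - exists n%:Z; rewrite -pmulrn divr_ge0 ?(ltW dp) //.
    by move: tl; rewrite ler_norml; lra.
  - exists (- n%:Z); rewrite mulrNz -pmulrn mulr_le0 ?invr_le0 ?(ltW dn) //.
    by move: tl; rewrite ler_norml; lra.
exists (Num.trunc ((t + l%:~R) / d)), l.
have := truncn_itv h; set j := Num.trunc _; move=> /andP[j1 j2].
have -> : j%:R * d - t - l%:~R = (j%:R - (t + l%:~R) / d) * d by field.
rewrite normrM ler_piMl // ler_norml; move: j2; rewrite -natr1; lra.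
Qed.

(* Dirichlet's pigeonhole argument. *)
Lemma irrational_small_multiple a e : (forall (m : nat) (l : int), (0 < m)%N ->
  m%:R * a != l%:~R) ->
  0 < e -> exists (m : nat) (l : int), (0 < m)%N /\ 0 < `|m%:R * a - l%:~R| < e.
Proof.
move=> irr e0.
have [Q Q0 Qe] : exists2 Q : nat, (0 < Q)%N & Q%:R^-1 <= e.
  exists (Num.trunc e^-1).+1 => //.
  rewrite -[leRHS]invrK lef_pV2 ?posrE ?invr_gt0 ?ltr0n //; exact: ltW (truncnS_gt _).
pose fr (k : nat) : R := k%:R * a - (Num.floor (k%:R * a))%:~R.
have fr01 k : 0 <= fr k < 1.
  rewrite /fr; have /andP[h1 h2] := floor_itv (k%:R * a).
  by move: h2; rewrite intrD mulr1z; lra.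
have bin k : (Num.trunc (fr k * Q%:R) < Q)%N.
  have /andP[f0 f1] := fr01 k.
  rewrite -(ltr_nat R); apply: (@le_lt_trans _ _ (fr k * Q%:R)).
    by have /andP[] := truncn_itv (mulr_ge0 f0 (ler0n _ Q)).
  by rewrite gtr_pMl // ltr0n.
pose f (k : 'I_Q.+1) : 'I_Q := Ordinal (bin k).
have [i [j [ij fij]]] : exists i j : 'I_Q.+1, (i < j)%N /\ f i = f j.
  have : ~~ injectiveb f.
    apply/negP => /injectiveP /leq_card; rewrite !card_ord; by rewrite ltnn.
  case/injectivePn => i [j ij fij].
  case: (ltngtP i j) => h; [by exists i, j| by exists j, i | by rewrite (val_inj h) eqxx in ij].
exists (j - i)%N, (Num.floor (j%:R * a) - Num.floor (i%:R * a)).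
split; first by rewrite subn_gt0.
rewrite normr_gt0 subr_eq0 irr ?subn_gt0 //=.
have -> : (j - i)%:R * a - (Num.floor (j%:R * a) - Num.floor (i%:R * a))%:~R = fr j - fr i.
  by rewrite /fr natrB ?(ltnW ij) // intrB; ring.
apply: lt_le_trans Qe; rewrite -[Q%:R^-1]mul1r ltr_pdivlMr ?ltr0n //.
rewrite -[X in _ * X]ger0_norm ?ler0n // -normrM mulrBl.
have /andP[i1 i2] := truncn_itv (mulr_ge0 (proj1 (andP (fr01 i))) (ler0n _ Q)).
have /andP[j1 j2] := truncn_itv (mulr_ge0 (proj1 (andP (fr01 j))) (ler0n _ Q)).
have E : Num.trunc (fr i * Q%:R) = Num.trunc (fr j * Q%:R) by have := congr1 val fij.
move: i1 i2 j1 j2; rewrite E -natr1 ltr_norml; lra.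
Qed.

(** The multiples of a small nonzero d = m a - l come within |d| of every point modulo 1. Starting
    from N a forces the multiplier to be at least N. *)
Lemma irrational_dense a t e N : (forall (m : nat) (l : int), (0 < m)%N -> m%:R * a != l%:~R) ->
  0 < e -> exists (m : nat) (l : int), (N <= m)%N /\ `|m%:R * a - l%:~R - t| < e.
Proof.
move=> irr e0; have [m [l [m0 /andP[d0 de]]]] := irrational_small_multiple irr e0.
set d := m%:R * a - l%:~R in d0 de.
have [j [l' h]] := @int_multiple_near d (t - N%:R * a) ltac:(by rewrite -normr_gt0).
exists (N + j * m)%N, (j%:Z * l + l'); split; first exact: leq_addr.
apply: le_lt_trans de; move: h; congr (`|_| <= _).
by rewrite /d natrD natrM intrD intrM; ring.
Qed.

End IrrationalRotation.

Lemma sin_periodz (R : realType) (a : R) (z : int) : sin (a + 2 * pi * z%:~R) = sin a.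
Proof. by rewrite -!cosBpihalf addrAC cos_periodz. Qed.

Lemma norm_atan (R : realType) (x : R) : `|atan x| <= `|x|.
Proof.
have := @lipschitz1 R (@atan R) (fun x => (1 + x ^+ 2)^-1) _ _ x 0.
rewrite atan0 !subr0; apply => z.
rewrite ger0_norm ?invr_ge0 ?addr_ge0 ?sqr_ge0 // invf_le1 ?lerDl ?sqr_ge0 //.
by rewrite ltr_wpDr ?sqr_ge0.
Qed.

(** * Powers of 8 + i in polar form and the dense G_delta of directions *)

Section Directions.
Variable R : realType.
Local Notation plane := (R * R)%type.
Implicit Types (y u : plane) (t : R).

Definition rho : R := Num.sqrt 65.

Lemma rho_gt0 : 0 < rho.
Proof. by rewrite sqrtr_gt0. Qed.

Lemma sqr_rho : rho ^+ 2 = 65.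
Proof. by rewrite sqr_sqrtr. Qed.

Lemma rho_ge2 : 2 <= rho.
Proof. by rewrite -(@ler_sqr R) ?nnegrE ?(ltW rho_gt0) // sqr_rho; lra. Qed.

(** The argument of theta = 8 + i, whose modulus is [rho]. *)
Definition ang : R := acos (8 / rho).

Lemma cos_ang : cos ang = 8 / rho.
Proof.
rewrite /ang acosK // in_itv /=.
have h8 : 0 <= 8 / rho by rewrite divr_ge0 // ltW // rho_gt0.
apply/andP; split; first by lra.
by rewrite ler_pdivrMr ?rho_gt0 // mul1r -(@ler_sqr R) ?nnegrE ?(ltW rho_gt0) // sqr_rho; lra.
Qed.

Lemma sin_ang : sin ang = rho^-1.
Proof.
have s0 : 0 <= sin ang.
  have h8 : 0 <= 8 / rho by rewrite divr_ge0 // ltW // rho_gt0.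
  have b : -1 <= 8 / rho <= 1 by rewrite -cos_ang cos_geN1 cos_le1.
  by rewrite /ang sin_acos // sqrtr_ge0.
apply/eqP; rewrite -(@eqrXn2 _ 2) // ?invr_ge0 ?(ltW rho_gt0) //.
rewrite sin2cos2 cos_ang exprMn exprVn sqr_rho; apply/eqP; lra.
Qed.

Lemma vec_polar M : vec R M = (rho ^+ M * cos (M%:R * ang), rho ^+ M * sin (M%:R * ang)).
Proof.
have r0 : rho != 0 by rewrite gt_eqF // rho_gt0.
elim: M => [|M IH]; first by rewrite /vec /= !mul0r cos0 sin0 mulr1 mulr0.
have -> : M.+1%:R * ang = M%:R * ang + ang by rewrite -natr1 mulrDl mul1r.
rewrite /vec iterS -/(vec R M) IH /gmul /= cosD sinD cos_ang sin_ang.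
by rewrite exprS; congr pair; field.
Qed.

(* Modulo 5, [gmul] fixes (3, 1), which is its value at (1, 0); so the second
   coordinate of [vec M.+1] never vanishes and 8 + i has irrational argument. *)
Lemma vec_mod5 M : exists j k : int,
  vec R M.+1 = ((5 * j + 3)%:~R, (5 * k + 1)%:~R).
Proof.
elim: M => [|M [j [k E]]].
  exists 1, 0; rewrite /vec /= /gmul /=; congr pair;
    rewrite ?mulr0 ?mulr1 ?subr0 ?addr0 ?add0r //.
exists (8 * j - k + 4), (j + 8 * k + 2).
by rewrite /vec iterS -/(vec R M.+1) E /gmul /=; congr pair; rewrite !(intrD, intrB, intrM); ring.
Qed.

Lemma ang_irrational (m : nat) (l : int) : (0 < m)%N -> m%:R * (ang / (2 * pi)) != l%:~R.
Proof.
case: m => // m _; apply/eqP => h.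
have pi0 : 2 * pi != 0 :> R by rewrite mulf_neq0 // gt_eqF // pi_gt0.
have E : m.+1%:R * ang = 0 + 2 * pi * l%:~R.
  by rewrite -h add0r; move: pi0; set p := 2 * pi => pi0; field.
have [j [k]] := vec_mod5 m; rewrite vec_polar E sin_periodz sin0 mulr0 => -[_ /eqP].
by rewrite eq_sym intr_eq0 => /eqP; lia.
Qed.

Definition circle_pt t : plane := (cos t, sin t).

(** Irrationality of the argument gives a large M with theta^M pointing close to angle t0; adding y
    turns so long a vector only slightly. The witnesses t and xi are an argument and the modulus of
    theta^M + y. *)
Lemma direction_near y t0 e N : 0 < e ->
  exists t xi M, [/\ `|t - t0| < e, (N <= M)%N & scl xi (circle_pt t) = vec R M + y].
Proof.
move=> e0; have pi0 : 0 < pi :> R := pi_gt0 R.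
pose K := `|y.1| + `|y.2|; have K0 : 0 <= K by rewrite addr_ge0.
(* This size of M makes the radial part A exceed 2 K / e, so the turn caused by y is below e/2; an
   error e / (4 pi) in whole turns accounts for the other e/2. *)
pose N1 := maxn N (Num.trunc (K + 1 + 2 * K / e)).+1.
have e4 : 0 < e / (4 * pi) by rewrite divr_gt0 // mulr_gt0.
have [M [l [NM hl]]] := @irrational_dense R (ang / (2 * pi)) (t0 / (2 * pi)) _ N1
  ang_irrational e4.
have MK : K + 1 + 2 * K / e < rho ^+ M.
  apply: (@lt_le_trans _ _ M%:R).
    apply: (lt_le_trans (truncnS_gt _)); rewrite ler_nat (leq_trans _ NM) //.
    exact: leq_maxr.
  apply: (@le_trans _ _ (2 ^+ M)); last by rewrite lerXn2r ?nnegrE ?(ltW rho_gt0) // rho_ge2.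
  by rewrite -natrX ler_nat ltnW // ltn_expl.
pose a := M%:R * ang; pose c := cos a; pose s := sin a.
have cs : c ^+ 2 + s ^+ 2 = 1 by exact: cos2Dsin2.
(* z1 + i z2 is y rotated by -a, so theta^M + y is A + i z2 rotated by a, with A = rho^M + z1. Hence
   v is the additional angle and A / cos v the modulus. *)
pose z1 := y.1 * c + y.2 * s; pose z2 := - y.1 * s + y.2 * c.
have zb (p q : R) : `|p| <= 1 -> `|q| <= 1 -> `|y.1 * p + y.2 * q| <= K.
  by move=> p1 q1; rewrite (le_trans (ler_normD _ _)) // !normrM lerD // ler_piMr.
have z1K : `|z1| <= K by apply: zb; [exact: cos_max | exact: sin_max].
have z2K : `|z2| <= K.
  by rewrite /z2 mulNr -mulrN; apply: zb; [rewrite normrN; exact: sin_max | exact: cos_max].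
pose A := rho ^+ M + z1.
have A0 : 1 + 2 * K / e < A by move: z1K; rewrite ler_norml /A => /andP[]; lra.
have Ke0 : 0 <= 2 * K / e by rewrite divr_ge0 ?mulr_ge0 // ltW.
have A1 : 0 < A by lra.
pose v := atan (z2 / A).
have vb : `|v| < e / 2.
  apply: (le_lt_trans (norm_atan _)).
  rewrite normrM normfV [`|A|]ger0_norm ?(ltW A1) // ltr_pdivrMr // (le_lt_trans z2K) //.
  rewrite -ltr_pdivrMl ?divr_gt0 //; apply: le_lt_trans A0.
  by rewrite invf_div [2 / e * K]mulrAC lerDr.
have cv : cos v != 0.
  by rewrite gt_eqF // cos_gt0_pihalf // /v atan_gtNpi2 atan_ltpi2.
have sv : sin v = cos v * (z2 / A).
  by rewrite -[z2 / A]atanK -/v /tan mulrC divfK.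
exists (a - 2 * pi * l%:~R + v), (A / cos v), M; split.
- have -> : a - 2 * pi * l%:~R + v - t0 = (2 * pi) * (M%:R * (ang / (2 * pi)) - l%:~R - t0 /
  (2 * pi)) + v.
    have : pi != 0 :> R by rewrite gt_eqF.
    by rewrite /a; move: (pi : R) => p p0; field.
  rewrite (le_lt_trans (ler_normD _ _)) // [ltRHS](_ : _ = e / 2 + e / 2); last by field.
  rewrite ltrD // normrM ger0_norm ?mulr_ge0 ?(ltW pi0) //.
  rewrite -ltr_pdivlMl ?mulr_gt0 //; apply: (lt_le_trans hl).
  rewrite le_eqVlt; apply/orP; left; apply/eqP.
  have : pi != 0 :> R by rewrite gt_eqF.
  by move: (pi : R) => p p0; field.
- by apply: leq_trans NM; exact: leq_maxl.
- rewrite vec_polar -/a -/c -/s.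
  have -> : a - 2 * pi * l%:~R + v = (a + v) + 2 * pi * (- l)%:~R by rewrite mulrNz; ring.
  rewrite /circle_pt cos_periodz sin_periodz cosD sinD -/c -/s sv /scl /=.
  have A00 : A != 0 by rewrite gt_eqF.
  have y1E : y.1 = y.1 * (c ^+ 2 + s ^+ 2) by rewrite cs mulr1.
  have y2E : y.2 = y.2 * (c ^+ 2 + s ^+ 2) by rewrite cs mulr1.
  have e1 : A / cos v * (c * cos v - s * (cos v * (z2 / A))) = A * c - s * z2 by field;
    rewrite cv A00.
  have e2 : A / cos v * (s * cos v + c * (cos v * (z2 / A))) = A * s + c * z2 by field;
    rewrite cv A00.
  rewrite e1 e2 /A /z1 /z2; congr pair.
  + by rewrite /= [in RHS]y1E; ring.
  + by rewrite /= [in RHS]y2E; ring.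
Qed.

Lemma circle_ptP u : unit_circle u -> exists t, u = circle_pt t.
Proof.
case: u => a b; rewrite /unit_circle /= => ab.
have a1 : -1 <= a <= 1.
  have : a ^+ 2 <= 1 ^+ 2 by rewrite expr1n -ab lerDl sqr_ge0.
  by rewrite -[leLHS]real_normK ?num_real // ler_sqr ?nnegrE // ler_norml.
have sb : sin (acos a) = `|b|.
  rewrite sin_acos // -sqrtr_sqr; congr Num.sqrt; lra.
have [b0|b0] := leP 0 b.
- by exists (acos a); rewrite /circle_pt sb acosK ?in_itv //= ger0_norm.
- by exists (- acos a); rewrite /circle_pt cosN sinN sb acosK ?in_itv //= ltr0_norm // opprK.
Qed.

Lemma unit_circle_pt t : unit_circle (circle_pt t).
Proof. exact: cos2Dsin2. Qed.

Lemma continuous_circle_pt : continuous circle_pt.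
Proof. move=> t; exact: (cvg_pair (@continuous_cos R t) (@continuous_sin R t)). Qed.

(** A version of [freq] with strict inequalities, which make the set open. *)
Definition near_freq y (k : nat) : set plane := [set u | exists M xi, (k <= M)%N /\
  `|xi * u.1 - (vec R M + y).1| < k.+1%:R^-1 /\ `|xi * u.2 - (vec R M + y).2| < k.+1%:R^-1].

Lemma near_freqP y k u : near_freq y k u -> exists xi, freq y u k xi.
Proof.
by move=> [M [xi [kM [h1 h2]]]]; exists xi; exists M => //; split => /=; exact: ltW.
Qed.

Lemma open_near_freq y k : open (near_freq y k).
Proof.
have -> : near_freq y k = \bigcup_(M in [set M | (k <= M)%N]) \bigcup_(xi in [set: R])
   ([set u : plane | `|xi * u.1 + 0 * u.2 - (vec R M + y).1| < k.+1%:R^-1] `&`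
    [set u : plane | `|0 * u.1 + xi * u.2 - (vec R M + y).2| < k.+1%:R^-1]).
  apply/seteqP; split => u.
    move=> [M [xi [kM [h1 h2]]]]; exists M => //; exists xi => //; split => /=;
    by rewrite mul0r ?addr0 ?add0r.
  move=> [M kM [xi _ [/= h1 h2]]]; exists M, xi; split => //; split; move: h1 h2;
  by rewrite !mul0r ?addr0 ?add0r.
apply: bigcup_open => M _; apply: bigcup_open => xi _.
have op (a b c r : R) : open [set u : plane | `|a * u.1 + b * u.2 - c| < r].
  have -> : [set u : plane | `|a * u.1 + b * u.2 - c| < r] =
      (fun u => a * u.1 + b * u.2 - c) @^-1` (ball (0 : R) r).
    by apply/seteqP; split => u /=; rewrite /ball /= sub0r normrN.
  apply: open_comp; last exact: ball_open.
  by move=> u _; exact: continuous_affine.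
exact: openI.
Qed.

Lemma dense_near_freq y k : dense (circle_pt @^-1` near_freq y k).
Proof.
move=> O [t0 Ot0] oO.
have /nbhs_ballP[e /= e0 be] : nbhs t0 O by exact: open_nbhs_nbhs.
have [t [xi [M [te kM E]]]] := direction_near y t0 k e0.
exists t; split; first by apply: be; rewrite /ball /= distrC.
exists M, xi; split => //.
by rewrite -E /scl /= !subrr normr0 invr_gt0 ltr0n.
Qed.

Lemma dense_setI (T : topologicalType) (A B : set T) : open A -> dense A -> dense B ->
  dense (A `&` B).
Proof.
move=> oA dA dB O O0 oO.
have [x [[Ox Ax] Bx]] := dB _ (dA _ O0 oO) (openI oO oA).
by exists x.
Qed.

(** Baire's theorem is applied on the line of angles and carried over to the circle by [circle_pt].
    Three shifts are intersected at once, so that both sets of directions are covered. *)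
Lemma typical_dense_Gdelta (D : set plane) (y1 y2 y3 : plane) :
  (forall u, unit_circle u -> (forall N, exists xi, freq y1 u N xi) ->
     (forall N, exists xi, freq y2 u N xi) -> (forall N, exists xi, freq y3 u N xi) -> D u) ->
  contains_dense_Gdelta_of_S D.
Proof.
move=> HD; pose O k := near_freq y1 k `&` (near_freq y2 k `&` near_freq y3 k).
have oO k : open (O k) by do 2 (apply: openI; first exact: open_near_freq); exact: open_near_freq.
exists O; split => //; split.
  move=> u [u1 Ou]; apply: HD => // N; have [a [b c]] := Ou N I; exact: near_freqP.
move=> U oU [u0 [Uu0 /circle_ptP[t0 E]]].
have oF y k : open (circle_pt @^-1` near_freq y k).
  by apply: open_comp => [t _|]; [exact: continuous_circle_pt | exact: open_near_freq].
have dF k : open (circle_pt @^-1` O k) /\ dense (circle_pt @^-1` O k).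
  split; first by apply: open_comp => // t _; exact: continuous_circle_pt.
  apply: dense_setI; [exact: oF | exact: dense_near_freq |].
  by apply: dense_setI; [exact: oF | exact: dense_near_freq | exact: dense_near_freq].
have dI : dense (\bigcap_k (circle_pt @^-1` O k)) by exact: (@Baire R R).
have [t [Ut Ot]] := dI (circle_pt @^-1` U) ltac:(by exists t0; rewrite /= -E)
  ltac:(by apply: open_comp => // t _; exact: continuous_circle_pt).
by exists (circle_pt t); split => //; split; [exact: unit_circle_pt | exact: Ot].
Qed.

End Directions.

(** * The dimension *)

Section ExactDimension.
Variable R : realType.
Local Notation plane := (R * R)%type.
Variable mu : probability (R * R)%type R.
Hypothesis mu_ss : self_similar (@phi R) mu.
Implicit Types (x y : plane) (c : R).

Let r : R := (Num.sqrt 65)^-1.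

Let sqr_r : r ^+ 2 = 65^-1.
Proof. by rewrite /r exprVn sqr_sqrtr. Qed.

Let r_gt0 : 0 < r.
Proof. by rewrite invr_gt0 sqrtr_gt0. Qed.

Lemma measurable_eball x c : measurable (eball x c).
Proof.
have -> : eball x c = (fun y : plane => (y.1 - x.1) ^+ 2 + (y.2 - x.2) ^+ 2) @^-1` `]-oo, c ^+ 2[.
  by apply/seteqP; split => y /=; rewrite in_itv.
rewrite -[X in measurable X]setTI.
have mf : measurable_fun setT (fun y : plane => (y.1 - x.1) ^+ 2 + (y.2 - x.2) ^+ 2).
  by apply: measurable_funD; apply: measurable_funX; apply: measurable_funB.
by apply: mf => //; exact: measurable_itv.
Qed.

Lemma phi_eball i x c : phi i @^-1` eball (phi i x) (c * r) = eball x c.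
Proof.
apply/funext => y; rewrite /eball /preimage /mkset.
have -> : ((phi i y).1 - (phi i x).1) ^+ 2 + ((phi i y).2 - (phi i x).2) ^+ 2 =
    ((y.1 - x.1) ^+ 2 + (y.2 - x.2) ^+ 2) / 65 by rewrite /phi /=; field.
by rewrite exprMn sqr_r ltr_pM2r // invr_gt0.
Qed.

(** A ball of radius 4 about a point of the box contains the box, whose diameter is 5 sqrt 2 / 2.
    Each map scales the radius by r and carries weight 1/9; the other eight terms are dropped. *)
Lemma mu_eball_ge n x : stage n x -> ((9^-1 ^+ n)%:E <= mu (eball x (4 * r ^+ n)))%E.
Proof.
elim: n x => [|n IH] x.
  move=> [x1 x2]; rewrite !expr0 mulr1.
  have <- : mu (box (5 / 4)) = 1%E.
    rewrite -[LHS]fineK ?fine_mu_box // ge0_fin_numE //; exact: mu_box_lty.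
  apply: le_measure; rewrite ?inE; [exact: measurable_box|exact: measurable_eball|].
  by move=> y [y1 y2]; rewrite /eball /=; move: x1 x2 y1 y2; rewrite !ler_norml; nra.
move=> [i _ [x' Kx' <-]]; rewrite mu_ss.2; last exact: measurable_eball.
have -> : 4 * r ^+ n.+1 = 4 * r ^+ n * r by rewrite exprSr mulrA.
rewrite (bigD1 i) //= phi_eball.
apply: (@le_trans _ _ ((9^-1)%:E * mu (eball x' (4 * r ^+ n))))%E.
  by rewrite exprS EFinM lee_wpmul2l ?lee_fin ?invr_ge0 // IH.
by rewrite leeDl // sume_ge0 // => j _; rewrite mule_ge0 // lee_fin invr_ge0.
Qed.

(** A ball of radius at most 1/2 about a point of the piece i misses the images of the box under the
    other maps by [phi_sep], so only the term i survives at each level. *)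
Lemma mu_eball_le n x : stage n x -> (mu (eball x (2^-1 * r ^+ n)) <= (9^-1 ^+ n)%:E)%E.
Proof.
elim: n x => [|n IH] x.
  by move=> _; rewrite expr0; apply: probability_le1; exact: measurable_eball.
move=> [i _ [x' Kx' <-]]; rewrite mu_ss.2; last exact: measurable_eball.
have -> : 2^-1 * r ^+ n.+1 = 2^-1 * r ^+ n * r by rewrite exprSr mulrA.
rewrite (bigD1 i) //= phi_eball big1 => [|j ji].
  by rewrite adde0 exprS EFinM lee_wpmul2l ?lee_fin ?invr_ge0 // IH.
rewrite [mu _](_ : _ = 0%E) ?mule0 //.
apply: (@subset_measure0 _ _ _ mu _ (~` box (5 / 4))).
- by rewrite -[X in measurable X]setTI; apply: (measurable_phi j) => //; exact: measurable_eball.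
- by apply: measurableC; exact: measurable_box.
- move=> y; rewrite /eball /= => yB by_.
  have rn : (2^-1 * r ^+ n * r) ^+ 2 <= 4^-1.
    rewrite -mulrA -exprSr exprMn -exprM mulnC exprM sqr_r.
    have h65 : 65^-1 <= 1 :> R by lra.
    have h0 : 0 <= 65^-1 :> R by lra.
    have : 65^-1 ^+ n.+1 <= 1 :> R by exact: exprn_ile1.
    by move=> h; rewrite exprVn; lra.
  have sqr_half (a : R) : 1 / 2 < `|a| -> 4^-1 < a ^+ 2.
    by move=> h; rewrite -[a ^+ 2]real_normK ?num_real //; nra.
  case: (phi_sep ji by_ (stage_box Kx')) => /sqr_half h; move: yB; rewrite /phi /= in h *;
  set a := (_ - _) ^+ 2; set b := (_ - _) ^+ 2; have a0 : 0 <= a := sqr_ge0 _;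
    have b0 : 0 <= b := sqr_ge0 _; move: h; rewrite -/a -/b; lra.
- exact: mu_outside_box.
Qed.

(** The similarity dimension log 9 / log sqrt 65. *)
Let s : R := 2 * ln 9 / ln 65.

Let ln65_gt0 : 0 < ln 65 :> R.
Proof. by rewrite ln_gt0 //; lra. Qed.

Let ln9_gt0 : 0 < ln 9 :> R.
Proof. by rewrite ln_gt0 //; lra. Qed.

Let s_ln_r : s * ln r = - ln 9.
Proof.
have h : 2 * ln r = - ln 65.
  by rewrite mulr_natl -lnXn // sqr_r lnV ?posrE.
have h' : ln r = - ln 65 / 2 by lra.
by rewrite /s h'; field; rewrite gt_eqF.
Qed.

Lemma scale_between (e : R) : 0 < e -> e <= 2^-1 ->
  exists n, 2^-1 * r ^+ n.+1 <= e /\ e <= 2^-1 * r ^+ n.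
Proof.
move=> e0 e2.
have r1 : r < 1 by have := sqr_r; have := r_gt0; nra.
have ex : exists n, 2^-1 * r ^+ n.+1 <= e.
  have [N hN] := @pow_small R r 2^-1 e ltac:(by rewrite ltW) e0.
  exists N; have := hN N.+1 (leqnSn N).
  by rewrite ger0_norm ?mulr_ge0 ?exprn_ge0 ?invr_ge0 ?(ltW r_gt0) // mulrC.
case: (ex_minnP ex) => [[|n] h1 hmin]; first by exists 0%N; rewrite expr0 mulr1.
exists n.+1; split => //; rewrite leNgt; apply/negP => /ltW /hmin.
by rewrite ltnn.
Qed.

(** For e between r^(n+1)/2 and r^n/2 the mass lies between 9^-(n+3) and 9^-n. As s ln r = - ln 9,
    the terms in n cancel and the error is bounded uniformly in e. *)
Lemma ln_mu_eball x e : (forall n, stage n x) -> 0 < e -> e <= 2^-1 ->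
  `|ln (fine (mu (eball x e))) - s * ln e| <= 3 * ln 9 + s * ln 2.
Proof.
move=> Kx e0 e2; have [n [ne en]] := scale_between e0 e2.
have s0 : 0 <= s by rewrite divr_ge0 ?mulr_ge0 ?(ltW ln9_gt0) ?(ltW ln65_gt0).
have rn0 k : 0 < r ^+ k by rewrite exprn_gt0.
have sub c c' : 0 <= c -> c <= c' -> (mu (eball x c) <= mu (eball x c'))%E.
  move=> c0 cc'; apply: le_measure; rewrite ?inE; try exact: measurable_eball.
  move=> y; rewrite /eball /= => h; apply: lt_le_trans h _.
  by rewrite ler_sqr ?nnegrE // (le_trans c0).
have fin c : mu (eball x c) \is a fin_num by apply: fin_num_measure; exact: measurable_eball.
have up : fine (mu (eball x e)) <= 9^-1 ^+ n.
  rewrite -lee_fin fineK //; apply: le_trans (mu_eball_le (Kx n)).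
  exact: sub (ltW e0) en.
(* Two further levels suffice because 4 r^(n+3) = (4/65) r^(n+1) <= r^(n+1)/2. *)
have lo : 9^-1 ^+ n.+3 <= fine (mu (eball x e)).
  rewrite -lee_fin fineK //; apply: (le_trans (mu_eball_ge (Kx n.+3))).
  apply: sub; first by rewrite mulr_ge0 // ltW.
  apply: le_trans ne; rewrite [r ^+ n.+3](_ : _ = r ^+ n.+1 * 65^-1).
    by have := rn0 n.+1; lra.
  by rewrite -sqr_r -exprD addn2.
have p9 k : 0 < 9^-1 ^+ k :> R by rewrite exprn_gt0 // invr_gt0.
have ln9 k : ln (9^-1 ^+ k) = - (k%:R * ln 9) :> R.
  by rewrite lnXn ?invr_gt0 // lnV ?posrE // mulNrn mulr_natl.
have up' : ln (fine (mu (eball x e))) <= - (n%:R * ln 9).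
  by rewrite -ln9 ler_ln ?posrE // (lt_le_trans _ lo).
have lo' : - (n.+3%:R * ln 9) <= ln (fine (mu (eball x e))).
  by rewrite -ln9 ler_ln ?posrE // (lt_le_trans _ lo).
have lnr k : s * ln (2^-1 * r ^+ k) = - (s * ln 2) - k%:R * ln 9.
  rewrite lnM ?posrE ?invr_gt0 // lnV ?posrE // lnXn // mulrDr mulrN; congr (_ + _).
  by rewrite mulrnAr s_ln_r mulNrn mulr_natl.
have e_up : s * ln e <= - (s * ln 2) - n%:R * ln 9.
  rewrite -lnr ler_wpM2l // ler_ln ?posrE //; by rewrite mulr_gt0 // invr_gt0.
have e_lo : - (s * ln 2) - n.+1%:R * ln 9 <= s * ln e.
  rewrite -lnr ler_wpM2l // ler_ln ?posrE //; by rewrite mulr_gt0 // invr_gt0.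
have sl2 : 0 <= s * ln 2 by rewrite mulr_ge0 // ln_ge0 //; lra.
have N1 : n.+1%:R = n%:R + 1 :> R by rewrite -natr1.
have N3 : n.+3%:R = n%:R + 3 :> R by rewrite -addn3 natrD.
have l9 := ln9_gt0; rewrite N1 in e_lo; rewrite N3 in lo'.
move: (n%:R : R) up' lo' e_up e_lo => p up' lo' e_up e_lo.
by rewrite ler_norml; apply/andP; split; lra.
Qed.

Lemma exact_dim_log_ratio : exact_dim mu s.
Proof.
have : {ae mu, forall x, forall n, stage n x}.
  apply: ae_foralln => n; exists (~` stage n); split => //.
  - by apply: measurableC; exact: measurable_stage.
  - exact: mu_stage.
apply: filterS => x Kx; apply/cvgrPdist_le => e e0.
pose C : R := 3 * ln 9 + s * ln 2.
near=> t.
have t0 : 0 < t by near: t; exact: nbhs_right_gt.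
have t2 : t <= 2^-1 by near: t; apply: nbhs_right_le; rewrite invr_gt0.
(* Below this t the bounded error C divided by |ln t| is at most e. *)
have tC : t <= expR (- (C / e)) by near: t; apply: nbhs_right_le; exact: expR_gt0.
have lt0 : ln t < 0 by apply: ln_lt0; lra.
have lnt : ln t <= - (C / e) by rewrite -[leRHS]expRK ler_ln ?posrE // expR_gt0.
have := ln_mu_eball Kx t0 t2; rewrite -/C => h.
have -> : s - ln (fine (mu (eball x t))) / ln t = - (ln (fine (mu (eball x t))) - s * ln t) /
  ln t.
  by field; rewrite lt_eqF.
rewrite normrM normfV normrN [`|ln t|]ltr0_norm // ler_pdivrMr ?oppr_gt0 //.
apply: (le_trans h); rewrite mulrN lerNr -ler_pdivlMl // mulrC mulNr.
exact: lnt.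
Unshelve. all: by end_near.
Qed.

(** Amounts to 9^2 = 81 > 65. *)
Lemma dim_gt1 : 1 < s.
Proof.
rewrite /s.
rewrite ltr_pdivlMr // mul1r.
have -> : 2 * ln 9 = ln (9 ^+ 2) :> R by rewrite lnXn // mulr_natl.
by rewrite ltr_ln ?posrE //; lra.
Qed.

End ExactDimension.

(** The intervals [a n - c n, a n + c n] meet pairwise, so the supremum of their left endpoints lies
    in all of them. *)
Lemma interlocking_limit (R : realType) (a c : nat -> R) :
  (forall n m, `|a (n + m)%N - a n| <= c n) -> exists l, forall n, `|l - a n| <= c n.
Proof.
move=> h; have c0 n : 0 <= c n by apply: le_trans (h n 0%N).
have key n m : a n - c n <= a m + c m.
  case: (leqP n m) => [nm|/ltnW mn].
  - have := h n (m - n)%N; rewrite subnKC // ler_norml => /andP[]; have := c0 m; lra.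
  - have := h m (n - m)%N; rewrite subnKC // ler_norml => /andP[]; have := c0 n; lra.
pose A := [set x | exists n, x = a n - c n].
have Aub m : ubound A (a m + c m) by move=> x [n ->].
have A0 : A !=set0 by exists (a 0%N - c 0%N); exists 0%N.
exists (sup A) => n; rewrite ler_norml.
have h1 : sup A <= a n + c n by apply: ge_sup.
have h2 : a n - c n <= sup A by apply: ub_le_sup; [exists (a 0%N + c 0%N) | exists n].
by apply/andP; split; lra.
Qed.

(** * Existence of the self-similar measure *)

Section Existence.
Variable R : realType.
Local Notation plane := (R * R)%type.
Local Notation leb := (@lebesgue_measure R).
Implicit Types (x y : plane) (t : R) (i : 'I_9).

Definition cell i : set R := [set t | i%:R <= 9 * t < i%:R + 1].

Definition unit_itv : set R := [set t | 0 <= t < 1].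

(* The n-th partial sum of the point of the attractor whose digit sequence is the
   base-9 expansion of t in [0, 1); outside [0, 1) the value is (0, 0). The
   self-similar measure is the image of Lebesgue measure under the limit. *)
Fixpoint coding (n : nat) (t : R) : plane :=
  if n is n'.+1 then
    (\sum_(i < 9) \1_(cell i) t * (phi i (coding n' (9 * t - i%:R))).1,
     \sum_(i < 9) \1_(cell i) t * (phi i (coding n' (9 * t - i%:R))).2)
  else (0, 0).

Lemma cell_unit i t : cell i t -> unit_itv t /\ unit_itv (9 * t - i%:R).
Proof.
rewrite /cell /unit_itv /= => /andP[h1 h2].
have i0 : 0 <= i%:R :> R by [].
have i9 : i%:R + 1 <= 9 :> R by rewrite natr1 ler_nat.
by split; apply/andP; split; lra.
Qed.

Lemma cell_inj i j t : cell i t -> cell j t -> i = j.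
Proof.
rewrite /cell /= => /andP[h1 h2] /andP[h3 h4]; apply/val_inj/eqP.
have ij : (i < j.+1)%N by rewrite -(ltr_nat R) -[j.+1%:R]natr1; lra.
have ji : (j < i.+1)%N by rewrite -(ltr_nat R) -[i.+1%:R]natr1; lra.
by rewrite eqn_leq -ltnS ij -ltnS ji.
Qed.

Lemma cell_cover t : unit_itv t -> exists i, cell i t.
Proof.
rewrite /unit_itv /= => /andP[t0 t1].
have t90 : 0 <= 9 * t by lra.
have /andP[h1 h2] := truncn_itv t90.
have k9 : (Num.trunc (9 * t) < 9)%N by rewrite -(ltr_nat R); apply: le_lt_trans h1 _; lra.
by exists (Ordinal k9); rewrite /cell /= h1 /= natr1.
Qed.

Lemma coding_cell n i t : cell i t -> coding n.+1 t = phi i (coding n (9 * t - i%:R)).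
Proof.
move=> ct.
have E (F : 'I_9 -> R) : \sum_(j < 9) \1_(cell j) t * F j = F i.
  rewrite (bigD1 i) //= indicE mem_set // mul1r big1 ?addr0 // => j ji.
  rewrite indicE memNset ?mul0r // => cj; move/eqP: ji; apply; exact: cell_inj ct.
by rewrite [LHS]/= (E (fun j => (phi j (coding n (9 * t - j%:R))).1))
  (E (fun j => (phi j (coding n (9 * t - j%:R))).2)) -surjective_pairing.
Qed.

Lemma coding_out n t : ~ unit_itv t -> coding n t = (0, 0).
Proof.
case: n => // n nt; rewrite /=.
by rewrite !big1 // => i _; rewrite indicE memNset ?mul0r // => /cell_unit[].
Qed.

Lemma measurable_cell i : measurable (cell i).
Proof.
have -> : cell i = (fun t : R => 9 * t) @^-1` `[i%:R, i%:R + 1[.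
  by apply/seteqP; split => t /=; rewrite in_itv.
rewrite -[X in measurable X]setTI.
have mf : measurable_fun setT (fun t : R => 9 * t) by exact: measurable_funM.
by apply: mf => //; exact: measurable_itv.
Qed.

Lemma measurable_coding n : measurable_fun setT (coding n).
Proof.
elim: n => [|n IH]; first exact: measurable_cst.
have mp i : measurable_fun setT (fun t : R => phi i (coding n (9 * t - i%:R))).
  apply: (measurableT_comp (measurable_phi i)); apply: (measurableT_comp IH).
  by apply: measurable_funB => //; exact: measurable_funM.
apply: measurable_fun_pair; apply: measurable_sum => i; apply: measurable_funM.
- by apply: measurable_indic; exact: measurable_cell.
- exact: (measurableT_comp measurable_fst (mp i)).
- by apply: measurable_indic; exact: measurable_cell.
- exact: (measurableT_comp measurable_snd (mp i)).
Qed.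

Lemma coding_box n t : box (5 / 4) (coding n t).
Proof.
elim: n t => [|n IH] t; first by split; rewrite /= normr0; lra.
have [/cell_cover[i ct]|nt] := pselect (unit_itv t).
  by rewrite (coding_cell _ ct); apply: box_le (box_phi i (IH _)); lra.
by rewrite coding_out //; split; rewrite /= normr0; lra.
Qed.

Lemma box_phiB i (c : R) x y : box c (x - y) -> box (9 / 65 * c) (phi i x - phi i y).
Proof. by case=> /= h1 h2; split => /=; move: h1 h2; rewrite !ler_norml; lra. Qed.

(** The error bound after n digits: the box radius 5/4 contracted n times by 9/65. *)
Definition radius n : R := (9 / 65) ^+ n * (5 / 4).

Lemma radius_ge0 n : 0 <= radius n.
Proof. by rewrite mulr_ge0 // exprn_ge0. Qed.

Lemma radiusS n : radius n.+1 = 9 / 65 * radius n.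
Proof. by rewrite /radius exprS -!mulrA. Qed.

Lemma coding_cauchy n m t : box (radius n) (coding (n + m) t - coding n t).
Proof.
elim: n t => [|n IH] t.
  by rewrite add0n /radius expr0 mul1r subr0; exact: coding_box.
have [/cell_cover[i ct]|nt] := pselect (unit_itv t).
  by rewrite addSn !(coding_cell _ ct) radiusS; exact: box_phiB.
by rewrite !coding_out // subrr; split; rewrite /= normr0 radius_ge0.
Qed.

Lemma coding_limit : exists X : R -> plane, forall t n, box (radius n) (X t - coding n t).
Proof.
suff h t : exists x : plane, forall n, box (radius n) (x - coding n t) by have [X hX] :=
  choice h; exists X.
have [l1 h1] := @interlocking_limit R (fun n => (coding n t).1) radius (fun n m =>
  (coding_cauchy n m t).1).
have [l2 h2] := @interlocking_limit R (fun n => (coding n t).2) radius (fun n m =>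
  (coding_cauchy n m t).2).
by exists (l1, l2) => n; split; [exact: h1 | exact: h2].
Qed.

Lemma radius_cvg0 (u : nat -> R) (l : R) : (forall n, `|l - u n| <= radius n) -> u @ \oo --> l.
Proof.
move=> h; apply/cvgrPdist_le => e e0.
have [N hN] := @pow_small R (9 / 65) (5 / 4) e ltac:(lra) e0.
exists N => // n Nn; apply: (le_trans (h n)).
by apply: le_trans (hN n Nn); exact: ler_norm.
Qed.

Lemma box_eq x y : (forall n, box (2 * radius n) (x - y)) -> x = y.
Proof.
move=> h; suff e0 (a : R) : (forall n, `|a| <= 2 * radius n) -> a = 0.
  apply/eqP; rewrite -subr_eq0; apply/eqP; case: (x - y) h => p q h.
  by congr pair; apply: e0 => n; have [] := h n.
move=> ha; apply/eqP; apply: contraT; rewrite -normr_gt0 => a0.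
have [N hN] := @pow_small R (9 / 65) (5 / 4) (`|a| / 4) ltac:(lra) ltac:(lra).
have := hN N (leqnn N); have := ha N;
  rewrite -/(radius N) [`|radius N|]ger0_norm ?radius_ge0 //; lra.
Qed.

(** Nine times the pushforward under t -> 9 t - i has the right values on intervals, hence is
    Lebesgue measure by uniqueness. *)
Lemma lebesgue_scale (i : nat) (B : set R) : measurable B ->
  leb ((fun t : R => 9 * t - i%:R) @^-1` B) = ((9^-1)%:E * leb B)%E.
Proof.
move=> mB; pose f : measurableTypeR R -> measurableTypeR R := fun t : R => 9 * t - i%:R.
have mf : measurable_fun setT f by apply: measurable_funB => //; exact: measurable_funM.
have c0 : 0 <= 9 :> R by [].
pose m2 : {measure set (measurableTypeR R) -> \bar R} :=
  mscale (NngNum c0) (measure_function_pushforward__canonical__measure_function_Measure leb mf).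
have E : leb B = m2 B.
  apply: (@lebesgue_measure_unique R m2) => // X [[a b] _ <-].
  transitivity (9%:E * leb (f @^-1` `]a, b]%classic))%E; last by [].
  have -> : f @^-1` `]a, b]%classic = `](a + i%:R) / 9, (b + i%:R) / 9]%classic.
    by apply/seteqP; split => t; rewrite /f /= !in_itv /= => /andP[h1 h2]; apply/andP; split; lra.
  rewrite !lebesgue_measure_itv /= !lte_fin.
  have -> : ((a + i%:R) / 9 < (b + i%:R) / 9) = (a < b) by rewrite ltr_pM2r ?invr_gt0 // ltrD2r.
  case: ifP => _; last by rewrite mule0.
  by rewrite -!EFinD -EFinM; congr EFin; field.
have m2E : m2 B = (9%:E * leb (f @^-1` B))%E by [].
by rewrite E m2E muleA -EFinM mulVf ?mul1e.
Qed.

Lemma exists_self_similar : exists mu : probability plane R, self_similar (@phi R) mu.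
Proof.
have [X XE] := coding_limit.
have mX : measurable_fun setT X.
  rewrite (_ : X = fun t => ((X t).1, (X t).2)); last by apply/funext => t; case: (X t).
  apply: measurable_fun_pair.
  - apply: (@measurable_fun_cvg _ _ _ setT (fun n t => (coding n t).1)) => [n|t _].
      exact: (measurableT_comp measurable_fst (measurable_coding n)).
    by apply: radius_cvg0 => n; have [] := XE t n.
  - apply: (@measurable_fun_cvg _ _ _ setT (fun n t => (coding n t).2)) => [n|t _].
      exact: (measurableT_comp measurable_snd (measurable_coding n)).
    by apply: radius_cvg0 => n; have [] := XE t n.
have mXA A : measurable A -> measurable (X @^-1` A).
  by move=> mA; rewrite -[Y in measurable Y]setTI; exact: mX.
(* Both sides are close to the same approximation [coding n.+1 t], each within 9/65 [radius n], and
   n is arbitrary. *)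
have X_cell i t : cell i t -> X t = phi i (X (9 * t - i%:R)).
  move=> ct; apply: box_eq => n.
  have h1 := XE t n.+1; have h2 := box_phiB i (XE (9 * t - i%:R) n).
  rewrite (coding_cell _ ct) in h1; move: h1 h2; rewrite radiusS; set z := phi i (coding _ _).
  have r0 := radius_ge0 n.
  by move=> [/= a1 a2] [/= b1 b2]; split => /=; move: a1 a2 b1 b2; rewrite !ler_norml; lra.
have mI : measurable unit_itv.
  have -> : unit_itv = `[0, 1[%classic by apply/seteqP; split => t /=; rewrite in_itv.
  exact: measurable_itv.
have lebI : leb unit_itv = 1%E.
  have -> : unit_itv = `[0, 1[%classic by apply/seteqP; split => t /=; rewrite in_itv.
  by rewrite lebesgue_measure_itv /= lte_fin ltr01 sube0.
pose m0 : {measure set (measurableTypeR R) -> \bar R} := mrestr leb mI.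
pose m : {measure set plane -> \bar R} :=
  measure_function_pushforward__canonical__measure_function_Measure m0 mX.
have mE A : m A = leb (X @^-1` A `&` unit_itv) by [].
have mT : m setT = 1%E by rewrite mE preimage_setT setTI lebI.
pose mu : probability plane R := HB.pack (m : set plane ->
  \bar R) (Measure.class m) (Measure_isProbability.Build _ _ _ m mT).
have muE A : mu A = leb (X @^-1` A `&` unit_itv) by [].
exists mu; split.
  exists (box (5 / 4)); split; first exact: compact_box.
  rewrite muE (_ : _ `&` _ = set0) ?measure0 //; apply/seteqP; split => // t [/= nb _]; apply: nb.
  by have := XE t 0%N; rewrite /radius expr0 mul1r subr0.
move=> A mA; rewrite muE.
(* Splitting [0, 1) into the nine cells yields the nine terms; on cell i the map t -> 9 t - i
   rescales to [0, 1) and produces the weight 1/9. *)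
have -> : X @^-1` A `&` unit_itv = \big[setU/set0]_(i < 9) (X @^-1` A `&` cell i).
  apply/seteqP; split => [t [XA /cell_cover[i ci]]|t].
    by rewrite (bigD1 i) //; left.
  elim/big_ind: _ => [//|B C hB hC [/hB|/hC] //|i _ [XA /cell_unit[ut _]]] //.
rewrite measure_bigsetU_ord.
- apply: eq_bigr => i _; rewrite muE.
  rewrite -(lebesgue_scale i); last by apply: measurableI => //; apply: mXA;
    rewrite -[Y in measurable Y]setTI; exact: measurable_phi.
  congr (leb _); apply/seteqP; split => t /=.
    by move=> [XA ci]; split; [rewrite -X_cell | have [] := cell_unit ci].
  move=> [XA ui]; have ci : cell i t by move: ui; rewrite /unit_itv /cell /=; lra.
  by split => //; rewrite (X_cell i).
- by move=> i; apply: measurableI; [exact: mXA | exact: measurable_cell].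
- by move=> i j _ _ [t [[_ ci] [_ cj]]]; exact: cell_inj ci cj.
Qed.

End Existence.

(** * The linear part as a rotation of infinite order *)

Section Rotation.
Variable R : realType.

(** Multiplication by theta/|theta|; since 1/conj(theta) = theta/65, it is the rotation part of the
    maps, with ratio 1/sqrt 65. *)
Definition rot_mx : 'M[R]_2 :=
  \matrix_(i, j) (Num.sqrt 65 / 65 * (if i == j then 8 else if i == 0 then - 1 else 1)).

Lemma mxapp_rot_mx x : mxapp rot_mx x = (Num.sqrt 65 / 65 * (gmul x).1, Num.sqrt 65 / 65 *
  (gmul x).2).
Proof. by rewrite /mxapp /rot_mx !mxE /=; congr pair; rewrite /gmul /=; ring. Qed.

Lemma sim_map_phi i : sim_map (Num.sqrt 65)^-1 rot_mx (digit R i) = phi i.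
Proof.
have s2 : (Num.sqrt 65)^-1 * (Num.sqrt 65 / 65) = 65^-1 :> R.
  by rewrite mulKf // gt_eqF // sqrtr_gt0.
apply/funext => x; rewrite /sim_map mxapp_rot_mx /=.
by rewrite !(mulrA _ (Num.sqrt 65 / 65)) s2 /phi /gmul /=; congr pair; ring.
Qed.

Lemma rotation_rot_mx : rotation_mx rot_mx.
Proof.
have s2 : (Num.sqrt 65 / 65) ^+ 2 = 65^-1 :> R.
  by rewrite exprMn sqr_sqrtr //; field.
set q := Num.sqrt 65 / 65 in s2.
split.
- apply/matrixP => i j; rewrite !mxE !big_ord_recl big_ord0 !mxE addr0 -/q.
  case: i => -[|[|//]] ? ; case: j => -[|[|//]] ?; rewrite /=; 
  by rewrite ?mulr1n ?mulr0n; move: s2; lra.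
- rewrite (expand_det_row _ 0) !big_ord_recl big_ord0 /cofactor !det_mx11 !mxE /= -/q addr0.
  rewrite ?expr0 ?expr1 ?addn0; move: s2; lra.
Qed.

Lemma mxapp_mul (A B : 'M[R]_2) x : mxapp (A *m B) x = mxapp A (mxapp B x).
Proof.
have S (F : 'I_2 -> R) : \sum_j F j = F 0 + F 1.
  by rewrite !big_ord_recl big_ord0 addr0; congr (F _ + F _); exact: val_inj.
by rewrite /mxapp !mxE !S /=; congr pair; ring.
Qed.

(** The k-th power sends (1, 0) to a positive multiple of theta^k, whose second coordinate is 1
    modulo 5 and hence nonzero. *)
Lemma rot_mxX_neq1 k : (0 < k)%N -> rot_mx ^+ k != 1.
Proof.
case: k => // k _; apply/eqP => E.
have h n : mxapp (rot_mx ^+ n) (1, 0) = ((Num.sqrt 65 / 65) ^+ n * (vec R n).1, (Num.sqrt 65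
  / 65) ^+ n * (vec R n).2).
  elim: n => [|n IH].
    by rewrite !expr0 /mxapp !mxE /= !mulr0 !mulr1 !addr0.
  rewrite exprS mxapp_mul IH mxapp_rot_mx /vec iterS /gmul /=; congr pair; rewrite exprS; ring.
have [j [l V]] := vec_mod5 R k; have := congr1 snd (h k.+1).
rewrite V E /mxapp !mxE /= !(mulr0, mul0r, mulr1, addr0, add0r) => /eqP.
rewrite eq_sym mulf_eq0 expf_eq0 /= mulf_eq0 invr_eq0 pnatr_eq0 orbF.
by rewrite gt_eqF ?sqrtr_gt0 //= intr_eq0 => /eqP; lia.
Qed.

End Rotation.

Theorem theorem1p1 (R : realType) :
  exists (r : R) (Rm : 'M[R]_2) (n : nat) (a : 'I_n -> R * R),
    [/\ 0 < r < 1, rotation_mx Rm /\ (forall k : nat, (0 < k)%N -> Rm ^+ k != 1),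
        (SSC (fun i => sim_map r Rm (a i))),
        (exists mu, self_similar (fun i => sim_map r Rm (a i)) mu) &
        forall mu : probability (R * R)%type R,
          self_similar (fun i => sim_map r Rm (a i)) mu ->
          [/\ (exists s : R, 1 < s /\ exact_dim mu s),
              contains_dense_Gdelta_of_S
                [set u | singular_leb (proj_measure mu u)] &
              contains_dense_Gdelta_of_S
                [set u | forall nu, is_disintegration mu u nu ->
                           {ae mu, forall x, discrete_measure (nu x)}]]].
Proof.
exists (Num.sqrt 65)^-1, (rot_mx R), 9%N, (@digit R).
have -> : (fun i => sim_map (Num.sqrt 65)^-1 (rot_mx R) (digit R i)) = @phi R.
  by apply/funext => i; exact: sim_map_phi.
split.
- rewrite invr_gt0 sqrtr_gt0 ltr0n /= invf_lt1 ?sqrtr_gt0 //.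
  by rewrite -[ltLHS]sqrtr1 ltr_sqrt //; lra.
- by split; [exact: rotation_rot_mx | exact: rot_mxX_neq1].
- exact: phi_SSC.
- exact: exists_self_similar.
- move=> mu mu_ss; split.
  + by exists (2 * ln 9 / ln 65); split; [exact: dim_gt1 | exact: exact_dim_log_ratio].
  + apply: (typical_dense_Gdelta (y1 := 0) (y2 := 0) (y3 := 0)) => u u1 f0 _ _.
    exact: singular_projection.
  (* Shifts of length 1/8 keep the phases 2 pi x_i / 8 in the range where the sine is injective. *)
  + apply: (typical_dense_Gdelta (y1 := 0) (y2 := (8^-1, 0)) (y3 := (0, 8^-1))) => u u1 _ f1 f2.
    exact: discrete_slices.
Qed.
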